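(* Let $\sigma\subset[n]$, let $m\ge\lambda\ge 1$ be integers and let $(\sigma_1,\ldots,\sigma_m)$ be a $\lambda$-uniform cover of $\sigma$. Then for any convex body $K\subset\mathbb{R}^n$, $$|K|^{m-\lambda}\,|P_{E_\sigma}K|^{\lambda}\le \frac{\prod_{i=1}^m\binom{n-|\sigma_i|}{n-|\sigma|}}{\binom{n}{n-|\sigma|}^{m-\lambda}}\prod_{i=1}^m|P_{E_{\sigma_i}}K|.$$
   Context: $[n]=\{1,\dots,n\}$ and $e_1,\dots,e_n$ is the standard orthonormal basis of $\mathbb{R}^n$. A convex body is a nonempty compact convex set. For $\tau\subset[n]$, $E_\tau:=\operatorname{span}\{e_i:i\in\tau\}^\perp$ and $|\tau|$ is the cardinality of $\tau$. Sets $\sigma_1,\dots,\sigma_m\subset\sigma$ form a $\lambda$-uniform cover of $\sigma$ if every $j\in\sigma$ belongs to exactly $\lambda$ of the sets $\sigma_i$. $P_E$ is the orthogonal projection onto the subspace $E$. For a convex body $K\subset\mathbb{R}^n$, $|K|$ is $n$-dimensional Lebesgue measure and $|P_EK|$ is the $(\dim E)$-dimensional Lebesgue measure on $E$, with $|P_EK|=1$ if $E=\{0\}$. *)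

(* Defs.v *)
From HB Require Import structures.
From mathcomp Require Import all_boot all_order all_algebra.
From mathcomp Require Import all_classical all_reals all_analysis.

Set Implicit Arguments.
Unset Strict Implicit.
Unset Printing Implicit Defensive.

Import Order.TTheory GRing.Theory Num.Theory.
Import numFieldNormedType.Exports.

Local Open Scope classical_set_scope.
Local Open Scope ring_scope.

Section sigma_finite_measure_of.
Context d (T : measurableType d) (R : realType).
Variables (m : {measure set T -> \bar R}) (sm : sigma_finite setT m).

Let mcopy of sigma_finite setT m : set T -> \bar R := m.

HB.instance Definition _ := Measure.copy (mcopy sm) m.

HB.instance Definition _ := @Measure_isSigmaFinite.Build _ _ _ (mcopy sm) sm.

Lemma sigma_finite_measure_of :
  exists m' : {sigma_finite_measure set T -> \bar R},
    m' = m :> (set T -> \bar R).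
Proof. by exists (mcopy sm). Qed.

End sigma_finite_measure_of.

Lemma product_sigma_finite_measure (R : realType) d1 d2
    (T1 : measurableType d1) (T2 : measurableType d2)
    (m1 : {sigma_finite_measure set T1 -> \bar R})
    (m2 : {sigma_finite_measure set T2 -> \bar R}) :
  exists m : {sigma_finite_measure set (T1 * T2)%type -> \bar R},
    m = (m1 \x m2)%E :> (set (T1 * T2) -> \bar R).
Proof.
pose m : {measure set (T1 * T2)%type -> \bar R} := (m1 \x m2)%E.
apply: (@sigma_finite_measure_of _ _ _ m).
have /sigma_finiteP[F [TF ndF Foo]] := sigma_finiteT m1.
have /sigma_finiteP[G [TG ndG Goo]] := sigma_finiteT m2.
exists (fun n => F n `*` G n).
  rewrite -setXTT TF TG predeqE => -[x y]; split.
    move=> [/= [n _ Fnx] [k _ Gky]]; exists (maxn n k) => //; split.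
    - by move: x Fnx; exact/subsetPset/ndF/leq_maxl.
    - by move: y Gky; exact/subsetPset/ndG/leq_maxr.
  by move=> [n _ []/= ? ?]; split; exists n.
move=> k; have [? ?] := Foo k; have [? ?] := Goo k.
split; first exact: measurableX.
by rewrite /m/= product_measure1E// lte_mul_pinfty// ge0_fin_numE.
Qed.

Lemma pushforward_sigma_finite_measure (R : realType) d1 d2
    (T1 : measurableType d1) (T2 : measurableType d2)
    (m : {sigma_finite_measure set T1 -> \bar R})
    (f : T1 -> T2) (g : T2 -> T1) :
  measurable_fun setT f -> measurable_fun setT g -> cancel f g ->
  exists m' : {sigma_finite_measure set T2 -> \bar R},
    m' = pushforward m f :> (set T2 -> \bar R).
Proof.
move=> mf mg fK.
pose q := (pushforward m f : {measure set T2 -> \bar R}).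
apply: (@sigma_finite_measure_of _ _ _ (q mf)).
have [F FT Foo] := sigma_finiteT m.
exists (fun k => g @^-1` F k).
  by rewrite -preimage_bigcup -FT preimage_setT.
move=> k; have [mFk Fkoo] := Foo k; split.
  by rewrite -[X in measurable X]setTI; exact: mg.
rewrite /q /= /pushforward -comp_preimage.
by rewrite (_ : g \o f = id)//; apply/funext => x; exact: fK.
Qed.

Section lebesgue_measure_tuple.
Context {R : realType}.
Local Notation RT := (measurableTypeR R).

Definition cons_pair n (p : RT * n.-tuple RT) : n.+1.-tuple RT :=
  [the n.+1.-tuple RT of p.1 :: p.2].

Lemma measurable_cons_pair n :
  measurable_fun [set: RT * n.-tuple RT] (@cons_pair n).
Proof. exact: measurable_cons. Qed.

(* In dimension 0 this is the Dirac mass at the unique point, so a singleton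
   has measure 1. *)
Fixpoint lebesgue_tuple (n : nat) : set (n.-tuple RT) -> \bar R :=
  match n return set (n.-tuple RT) -> \bar R with
  | 0 => \d_[tuple]
  | n'.+1 =>
      pushforward (lebesgue_measure \x @lebesgue_tuple n')%E (@cons_pair n')
  end.

Lemma lebesgue_tuple_sigma_finite_measure n :
  exists m : {sigma_finite_measure set (n.-tuple RT) -> \bar R},
    m = @lebesgue_tuple n :> (set (n.-tuple RT) -> \bar R).
Proof.
elim: n => [|n [m mE]]; first by exists \d_[tuple].
have [p pE] := product_sigma_finite_measure (@lebesgue_measure R) m.
pose g (t : n.+1.-tuple RT) : RT * n.-tuple RT :=
  (thead t, [tuple of behead t]).
have gK : cancel (@cons_pair n) g.
  by move=> [x t]; rewrite /g /cons_pair /=; congr pair; exact/val_inj.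
have mg : measurable_fun setT g.
  apply/measurable_fun_pair; first exact: measurable_tnth.
  exact: measurable_behead.
have [q qE] :=
  pushforward_sigma_finite_measure p (@measurable_cons_pair n) mg gK.
by exists q; rewrite qE /= -mE -pE.
Qed.

Lemma measurable_box n (A : 'I_n -> set RT) : (forall i, measurable (A i)) ->
  measurable [set t : n.-tuple RT | forall i, A i (tnth t i)].
Proof.
move=> mA; rewrite (_ : [set t | _] = \bigcap_(i in [set: 'I_n])
    ((fun t : n.-tuple RT => tnth t i) @^-1` A i)).
  apply: fin_bigcap_measurable => // i _.
  by rewrite -[X in measurable X]setTI; exact: measurable_tnth.
by rewrite predeqE => t; split=> [tA i _|tA i]; exact: tA.
Qed.

Lemma lebesgue_tuple_box n (A : 'I_n -> set RT) :
  (forall i, measurable (A i)) ->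
  lebesgue_tuple [set t : n.-tuple RT | forall i, A i (tnth t i)] =
  (\prod_(i < n) lebesgue_measure (A i))%E.
Proof.
elim: n A => [|n IH] A mA.
  rewrite big_ord0 /= diracE (_ : (_ \in _) = true)//.
  by apply/mem_set; case.
pose B i := A (lift ord0 i); have mB i : measurable (B i) by exact: mA.
rewrite big_ord_recl -(IH B)//= /pushforward.
have [m mE] := lebesgue_tuple_sigma_finite_measure n.
rewrite -mE -product_measure1E//; last exact: (measurable_box mB).
congr ((_ \x _)%E _); rewrite predeqE => -[x t] /=; split => [tA|[xA tA] i].
  by split=> [|i]; [have := tA ord0|have := tA (lift ord0 i); rewrite tnthS].
by case: (unliftP ord0 i) => [j|] ->; [rewrite tnthS; exact: tA|exact: xA].
Qed.

End lebesgue_measure_tuple.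

Section euclidean.
Context {R : realType} {n : nat}.
Implicit Types (x y z : 'rV[R]_n) (E A : set 'rV[R]_n) (tau : {set 'I_n}).

Definition convex_body A :=
  [/\ A !=set0, compact A & @convex_set R 'rV[R]_n A].

Definition volume A : \bar R :=
  lebesgue_tuple [set t | A (\row_i tnth t i)].

Definition dot x y : R := \sum_i x 0 i * y 0 i.

Definition orthocomplement (V : {vspace 'rV[R]_n}) : set 'rV[R]_n :=
  [set x | forall v, v \in V -> dot x v = 0].

Definition coord_subspace tau : set 'rV[R]_n :=
  orthocomplement (span [seq delta_mx 0 i | i <- enum tau]).

(* Total function; meaningful when E is a linear subspace, in which case the
   point selected exists and is unique. *)
Definition orthoproj E x : 'rV[R]_n :=
  xget 0 [set y | E y /\ forall z, E z -> dot (x - y) z = 0].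

(* Linear isometry from R^k, k = n - |tau|, onto coord_subspace tau, sending
   the standard basis to the e_i, i not in tau, in increasing order. *)
Definition coord_isometry tau (c : 'rV[R]_#|~: tau|) : 'rV[R]_n :=
  \sum_k c 0 k *: delta_mx 0 (enum_val k).

Definition uniform_cover (lambda m : nat) (s : {set 'I_n})
    (c : 'I_m -> {set 'I_n}) : Prop :=
  (forall i, c i \subset s) /\
  (forall j, j \in s -> #|[set i | j \in c i]| = lambda).

End euclidean.

Arguments coord_isometry {R n} tau c.

(* Lebesgue measure on coord_subspace tau, whose dimension is n - |tau|,
   transported along coord_isometry. *)
Definition coord_volume (R : realType) (n : nat) (tau : {set 'I_n})
    (A : set 'rV[R]_n) : \bar R :=
  volume [set c | A (coord_isometry tau c)].

Section coord_subspace_theory.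
Context {R : realType} {n : nat}.
Implicit Types (x y z : 'rV[R]_n) (tau : {set 'I_n}).

Lemma coord_subspaceP tau x :
  coord_subspace tau x <-> forall i, i \in tau -> x 0 i = 0.
Proof.
have dotd i : dot x (delta_mx 0 i) = x 0 i.
  rewrite /dot (bigD1 i)//= mxE !eqxx mulr1 big1 ?addr0// => j ji.
  by rewrite mxE eqxx/= (negbTE ji) mulr0.
split=> [xE i it|x0 v].
  rewrite -dotd; apply: xE; apply: memv_span.
  by apply: map_f; rewrite mem_enum.
move/coord_span ->; rewrite /dot.
under eq_bigr do rewrite summxE mulr_sumr.
rewrite exchange_big big1//= => j _.
set X := (X in X`_j); have /mapP[i] : X`_j \in X.
  by apply: mem_nth; rewrite size_tuple.
rewrite mem_enum => it ->.
under eq_bigr do rewrite mxE mulrCA.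
by rewrite -mulr_sumr -/(dot x _) dotd x0// mulr0.
Qed.

Lemma orthoproj_coordE tau x :
  orthoproj (coord_subspace tau) x =
  \row_i (if i \in tau then 0 else x 0 i).
Proof.
rewrite /orthoproj; apply: xget_unique.
  split; first by apply/coord_subspaceP => i it; rewrite mxE it.
  move=> z /coord_subspaceP z0; apply: big1 => i _; rewrite !mxE.
  by case: ifPn => [/z0->|_]; rewrite ?mulr0// subrr mul0r.
move=> y [/coord_subspaceP y0 yx]; apply/rowP => i; rewrite mxE.
case: ifPn => [/y0//|it].
have eE : coord_subspace tau (delta_mx 0 i : 'rV[R]_n).
  apply/coord_subspaceP => j jt; rewrite mxE eqxx /=.
  by case: eqP => // ji; rewrite -ji jt in it.
have := yx _ eE.
rewrite /dot (bigD1 i)//= !mxE !eqxx mulr1 big1 ?addr0 => [|j ji].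
  by move/eqP; rewrite subr_eq0 => /eqP.
by rewrite [delta_mx _ _ _ _]mxE eqxx/= (negbTE ji) mulr0.
Qed.

Lemma coord_isometryE tau (c : 'rV[R]_#|~: tau|) k :
  (coord_isometry tau c) 0 (enum_val k) = c 0 k.
Proof.
rewrite summxE (bigD1 k)//= !mxE !eqxx mulr1 big1 ?addr0// => j jk.
by rewrite !mxE eqxx/= (inj_eq enum_val_inj) eq_sym (negbTE jk) mulr0.
Qed.

Lemma coord_isometry_in tau (c : 'rV[R]_#|~: tau|) :
  coord_subspace tau (coord_isometry tau c).
Proof.
apply/coord_subspaceP => i it; rewrite summxE big1// => k _.
rewrite !mxE eqxx/=; case: eqP => [ik|]; last by rewrite mulr0.
by have := enum_valP k; rewrite -ik inE it.
Qed.

Lemma range_coord_isometry tau :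
  range (@coord_isometry R n tau) = coord_subspace tau.
Proof.
rewrite predeqE => x; split=> [[c _ <-]|xE]; first exact: coord_isometry_in.
exists (\row_k x 0 (enum_val k)) => //; apply/rowP => i.
have [it|it] := boolP (i \in tau).
  have := (coord_subspaceP _ _).1 (@coord_isometry_in tau _) i it.
  by move=> ->; move/coord_subspaceP : xE => /(_ i it).
have it' : i \in ~: tau by rewrite inE.
by rewrite -(enum_rankK_in it' it') coord_isometryE mxE.
Qed.

Lemma dot_coord_isometry tau (c d : 'rV[R]_#|~: tau|) :
  dot (coord_isometry tau c) (coord_isometry tau d) = dot c d.
Proof.
rewrite /dot (bigID (mem (~: tau)))/= [X in _ + X]big1 ?addr0 => [|i].
  rewrite big_enum_val/=; apply: eq_bigr => k _.
  by rewrite !coord_isometryE.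
rewrite inE negbK => it.
by rewrite ((coord_subspaceP _ _).1 (coord_isometry_in c) i it) mul0r.
Qed.

End coord_subspace_theory.

(* Main.v *)
Require Import Defs.
From mathcomp Require Import all_boot all_order all_algebra.
From mathcomp Require Import all_classical all_reals all_analysis.
From mathcomp Require Import measurable_realfun ring.
Import Order.TTheory GRing.Theory Num.Theory.
Import numFieldNormedType.Exports.
Set Implicit Arguments.
Unset Strict Implicit.
Unset Printing Implicit Defensive.
Local Open Scope classical_set_scope.
Local Open Scope ring_scope.

(* Put s = |sigma|, d = n - s, p = m - lambda, k_i = s - |sigma_i|, Q = P_{E_sigma} K, and for
   y in Q let g_i(y) be the k_i-dimensional volume of the fibre over y of P_{E_{sigma_i}} K -> Q,
   so that |P_{E_{sigma_i}} K| is the integral of g_i over Q.  The sets sigma \ sigma_i form a p-uniform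
   cover of sigma, hence the fibre K_y satisfies |K_y|^p <= prod_i g_i(y).  By Brunn's theorem
   phi_i = g_i^(1/k_i) is concave on Q, and Hoelder's inequality with exponents k_i/(sp) gives
   |K| <= prod_i (int_Q phi_i^s)^(k_i/(sp)).  Berwald's inequality
   ('C(d+s,s)/|Q| int_Q phi_i^s)^(1/s) <= ('C(d+k_i,k_i)/|Q| int_Q phi_i^k_i)^(1/k_i)
   then bounds each factor by a power of |P_{E_{sigma_i}} K|, with exactly the binomial constants of
   the statement.

   All integrals are iterated one-dimensional integrals over a segment [-b, b] with K in [-b, b]^n,
   taken coordinate by coordinate (margs); the order of the coordinates is irrelevant by Tonelli. *)

(** * Integrals of bounded nonnegative functions *)

Section bounded_integrals.
Context {R : realType}.
Local Notation mu := (@lebesgue_measure R).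

(** The power [s] is forced by the fibre bound: the product of the [g_i^(1/p)] is the product of the
    [(phi_i^s)^(k_i/(sp))], and these exponents add up to 1 because the [k_i] add up to [s p]. As
    [k_i <= s], Berwald's inequality runs in the required direction. Its binomials are reciprocals
    of beta integrals, the moments of the cone profile [(1 - r)^d], for which it is an equality.
    Since the [k_i/s] add up to [p], the factor [C(d+s, s) = C(n, n-s)] comes out exactly [p] times.
    Both theorems about concave functions are reduced to one variable. Integrating out one
    coordinate turns a concave k-th root into a concave (k+1)-th root, starting at k = 0 from the
    indicator of a convex set; iteration gives Brunn's theorem. Berwald's inequality becomes a
    statement about the volumes of superlevel sets as a function of the level, whose d-th root is
    concave by Brunn's theorem again. The class [bmf] is closed under sums, products, powers and
    marginals, and its members are integrable on every bounded interval. *)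

Definition bmf d (T : measurableType d) (F : T -> R) : Prop :=
  [/\ measurable_fun setT F, forall x, 0 <= F x & exists M, forall x, F x <= M].

(** A real number, in which an infinite integral would be read as 0; it is meaningful for [bmf]
    functions, and [EFin_itg] leads back to extended reals for Tonelli's theorem. *)
Definition itg (a c : R) (f : R -> R) : R := \int[mu]_(t in `[a, c]) f t.

Lemma bmf_bound d (T : measurableType d) (F : T -> R) :
  bmf F -> exists2 M, 0 < M & forall x, F x <= M.
Proof.
case=> _ _ [M FM]; exists (Num.max M 1) => [|x]; first by rewrite lt_max ltr01 orbT.
by rewrite le_max FM.
Qed.

Lemma bmf_integrable (a c : R) (f : R -> R) : bmf f ->
  mu.-integrable `[a, c] (EFin \o f).
Proof.
move=> bf; have [mf f0 _] := bf; have [M M0 fM] := bmf_bound bf.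
apply: measurable_bounded_integrable => //.
- by rewrite /= lebesgue_measure_itv/=; case: ifP => // _; rewrite -EFinB ltry.
- exact: measurable_funS mf.
- exists M; split; first exact: num_real.
  by move=> y My x _ /=; rewrite ger0_norm ?f0// (le_trans (fM x)) ?ltW.
Qed.

Lemma EFin_itg (a c : R) (f : R -> R) : bmf f ->
  (itg a c f)%:E = (\int[mu]_(t in `[a, c]) (f t)%:E)%E.
Proof.
by move=> bf; rewrite fineK//; apply: integrable_fin_num => //; exact: bmf_integrable.
Qed.

Lemma itg_ge0 a c f : (forall t, 0 <= f t) -> 0 <= itg a c f.
Proof. by move=> f0; apply: Rintegral_ge0 => x _; exact: f0. Qed.

(** The endpoints are null sets. Leaving them out matters later: a superlevel set at the full height
    may be empty, and the comparison in [berwald_1d] is made for [r > 0]. *)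
Lemma le_itg (a c : R) (f g : R -> R) : bmf f -> bmf g ->
  (forall t, a < t < c -> f t <= g t) -> itg a c f <= itg a c g.
Proof.
move=> bf bg fg.
have itgoo h : bmf h -> itg a c h = \int[mu]_(t in `]a, c[) h t.
  move=> bh; have ih := bmf_integrable a c bh.
  rewrite /itg -Rintegral_itv_obnd_cbnd -?Rintegral_itv_bndo_bndc//.
  - by apply: integrableS ih => //; apply: subset_itv; rewrite bnd_simp.
  - by apply: integrableS ih => //; apply: subset_itv; rewrite bnd_simp.
rewrite !itgoo//; apply: le_Rintegral => //.
- by apply: integrableS (bmf_integrable a c bf) => //; apply: subset_itv; rewrite bnd_simp.
- by apply: integrableS (bmf_integrable a c bg) => //; apply: subset_itv; rewrite bnd_simp.
Qed.

Lemma eq_itg (a c : R) (f g : R -> R) :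
  (forall t, a <= t <= c -> f t = g t) -> itg a c f = itg a c g.
Proof.
by move=> fg; apply: eq_Rintegral => x; rewrite inE/= in_itv/= => /fg.
Qed.

Lemma itg_cst (a c k : R) : a <= c -> itg a c (fun=> k) = k * (c - a).
Proof.
move=> ac; rewrite /itg Rintegral_cst//; congr (_ * _).
rewrite /= lebesgue_measure_itv/= lte_fin; case: ltrP => //= ca.
by rewrite (_ : c = a) ?subrr//; apply/le_anti; rewrite ca ac.
Qed.

Lemma itgZ (a c k : R) (f : R -> R) : bmf f -> itg a c (fun t => k * f t) = k * itg a c f.
Proof. by move=> bf; apply: RintegralZl => //; exact: bmf_integrable. Qed.

Lemma bmf_cst d (T : measurableType d) (k : R) : 0 <= k -> bmf (fun _ : T => k).
Proof. by move=> k0; split=> //; exists k. Qed.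

Lemma bmfD d (T : measurableType d) (F G : T -> R) :
  bmf F -> bmf G -> bmf (fun x => F x + G x).
Proof.
move=> [mF F0 [M FM]] [mG G0 [N GN]]; split.
- exact: measurable_funD.
- by move=> x; rewrite addr_ge0.
- by exists (M + N) => x; rewrite lerD.
Qed.

Lemma bmfM d (T : measurableType d) (F G : T -> R) :
  bmf F -> bmf G -> bmf (fun x => F x * G x).
Proof.
move=> [mF F0 [M FM]] [mG G0 [N GN]]; split.
- exact: measurable_funM.
- by move=> x; rewrite mulr_ge0.
- by exists (M * N) => x; rewrite ler_pM.
Qed.

Lemma bmf_sum d (T : measurableType d) (I : Type) (r : seq I) (P : pred I)
    (F : I -> T -> R) :
  (forall i, bmf (F i)) -> bmf (fun x => \sum_(i <- r | P i) F i x).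
Proof.
move=> bF; elim: r => [|i r IH].
  rewrite (_ : (fun x => _) = fun=> 0); first exact: bmf_cst.
  by apply/funext => x; rewrite big_nil.
rewrite (_ : (fun x => _) = fun x => if P i then F i x + (\sum_(j <- r | P j) F j x)
    else \sum_(j <- r | P j) F j x); last first.
  by apply/funext => x; rewrite big_cons.
by case: (P i) => //; exact: (bmfD (bF i) IH).
Qed.

Lemma bmf_prod d (T : measurableType d) (I : Type) (r : seq I) (P : pred I)
    (F : I -> T -> R) :
  (forall i, bmf (F i)) -> bmf (fun x => \prod_(i <- r | P i) F i x).
Proof.
move=> bF; elim: r => [|i r IH].
  rewrite (_ : (fun x => _) = fun=> 1); first exact: bmf_cst.
  by apply/funext => x; rewrite big_nil.
rewrite (_ : (fun x => _) = fun x => if P i then F i x * (\prod_(j <- r | P j) F j x)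
    else \prod_(j <- r | P j) F j x); last first.
  by apply/funext => x; rewrite big_cons.
by case: (P i) => //; exact: (bmfM (bF i) IH).
Qed.

Lemma bmf_exp d (T : measurableType d) (F : T -> R) k :
  bmf F -> bmf (fun x => F x ^+ k).
Proof.
move=> [mF F0 [M FM]]; split; first exact: measurable_funX.
  by move=> x; rewrite exprn_ge0.
by exists (M ^+ k) => x; rewrite lerXn2r ?nnegrE// (le_trans (F0 x)).
Qed.

Lemma bmf_powR d (T : measurableType d) (F : T -> R) (p : R) : 0 <= p ->
  bmf F -> bmf (fun x => F x `^ p).
Proof.
move=> p0 [mF F0 [M FM]]; split.
- exact: (measurableT_comp (measurable_powR p)).
- by move=> x; exact: powR_ge0.
- by exists (M `^ p) => x; apply: ge0_ler_powR; rewrite ?nnegrE// (le_trans (F0 x)).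
Qed.

Lemma bmf_comp d1 d2 (T1 : measurableType d1) (T2 : measurableType d2)
    (F : T2 -> R) (h : T1 -> T2) :
  measurable_fun setT h -> bmf F -> bmf (fun x => F (h x)).
Proof.
move=> mh [mF F0 [M FM]]; split; [exact: measurableT_comp|by []|by exists M].
Qed.

Lemma bmf_indic d (T : measurableType d) (A : set T) : measurable A ->
  bmf (\1_A : T -> R).
Proof.
move=> mA; split; first exact: measurable_indic.
  by move=> x; rewrite indicE ler0n.
by exists 1 => x; rewrite indicE; case: (x \in A).
Qed.

Lemma itgD (a c : R) (f g : R -> R) : bmf f -> bmf g ->
  itg a c (fun t => f t + g t) = itg a c f + itg a c g.
Proof. by move=> bf bg; apply: RintegralD => //; exact: bmf_integrable. Qed.

Lemma itg_sum a c (I : Type) (r : seq I) (P : pred I) (F : I -> R -> R) :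
  (forall i, bmf (F i)) ->
  itg a c (fun t => \sum_(i <- r | P i) F i t) = \sum_(i <- r | P i) itg a c (F i).
Proof.
move=> bF; elim: r => [|i r IH].
  under eq_itg do rewrite big_nil.
  by rewrite big_nil /itg Rintegral_cst// mul0r.
under eq_itg do rewrite big_cons.
rewrite big_cons; case: ifP => // _; rewrite itgD ?IH//; exact: bmf_sum.
Qed.

Lemma integral_itv_patch a c (f : R -> R) :
  (\int[mu]_(t in `[a, c]) (f t)%:E = \int[mu]_t (f t * \1_(`[a, c]) t)%:E)%E.
Proof.
rewrite integral_mkcond; apply: eq_integral => t _; rewrite patchE indicE.
by case: ifP; rewrite ?mulr1 ?mulr0.
Qed.

(** Measurability in the parameter is Tonelli's theorem for [F] cut off to a strip; this is what
    allows marginals to be iterated. *)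
Lemma bmf_itg d (T : measurableType d) (F : T * R -> R) a c : bmf F ->
  bmf (fun x => itg a c (fun t => F (x, t))).
Proof.
move=> bF; have [mF F0 _] := bF; have [M M0 FM] := bmf_bound bF.
have bFx x : bmf (fun t => F (x, t)).
  by apply: (bmf_comp (h := pair x)) bF; exact: pair1_measurable.
split.
- pose G (z : T * R) : \bar R := (F z * \1_(`[a, c]) z.2)%:E.
  rewrite /itg /Rintegral.
  under eq_fun do rewrite integral_itv_patch.
  apply: (measurableT_comp (fine_measurable measurableT)).
  apply: (@measurable_fun_fubini_tonelli_F _ _ T (measurableTypeR R) R mu G).
    apply/measurable_EFinP; apply: measurable_funM => //.
    apply: measurableT_comp => //; exact: measurable_indic.
  by move=> z; rewrite lee_fin mulr_ge0.
- by move=> x; exact: itg_ge0.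
- exists (itg a c (fun=> M)) => x; apply: le_itg => //.
  exact/bmf_cst/ltW.
Qed.

Lemma itg_swap a1 c1 a2 c2 (F : R * R -> R) : bmf F ->
  itg a1 c1 (fun t => itg a2 c2 (fun u => F (t, u))) =
  itg a2 c2 (fun u => itg a1 c1 (fun t => F (t, u))).
Proof.
move=> bF; have [mF F0 _] := bF.
have bF1 x : bmf (fun t => F (x, t)).
  by apply: (bmf_comp (h := pair x)) bF; exact: pair1_measurable.
have bF2 x : bmf (fun t => F (t, x)).
  by apply: (bmf_comp (h := pair^~ x)) bF; exact: pair2_measurable.
have bFs : bmf (fun z : R * R => F (z.2, z.1)).
  by apply: (bmf_comp (h := fun z : R * R => (z.2, z.1))) bF; exact: measurable_swap.
apply: EFin_inj; rewrite EFin_itg; last exact: bmf_itg.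
rewrite EFin_itg; last exact: (bmf_itg _ _ bFs).
rewrite integral_itv_patch [RHS]integral_itv_patch.
pose G (z : R * R) : \bar R := (F z * \1_(`[a1, c1]) z.1 * \1_(`[a2, c2]) z.2)%:E.
transitivity (\int[mu]_t \int[mu]_u G (t, u))%E.
  apply: eq_integral => t _; rewrite mulrC EFinM EFin_itg// -ge0_integralZl//.
  - rewrite integral_mkcond; apply: eq_integral => u _; rewrite patchE /G/=.
    by rewrite !indicE; case: ifP => _; rewrite ?mulr1 ?mulr0// -EFinM mulrC.
  - by apply/measurable_EFinP; case: (bF1 t) => m _ _; exact: measurable_funS m.
  - by move=> x _; rewrite lee_fin.
transitivity (\int[mu]_u \int[mu]_t G (t, u))%E.
  apply: (@fubini_tonelli _ _ (measurableTypeR R) (measurableTypeR R) R mu mu G).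
  - apply/measurable_EFinP; apply: measurable_funM.
      apply: measurable_funM => //.
      by apply: measurableT_comp => //; exact: measurable_indic.
    by apply: measurableT_comp => //; exact: measurable_indic.
  - by move=> z; rewrite lee_fin !mulr_ge0.
apply: eq_integral => u _; rewrite mulrC EFinM EFin_itg// -ge0_integralZl//.
- rewrite [RHS]integral_mkcond; apply: eq_integral => t _; rewrite patchE /G/=.
  rewrite !indicE; case: ifP => _; rewrite ?mulr1 ?mulr0 ?mul0r//.
  by rewrite -EFinM mulrC.
- by apply/measurable_EFinP; case: (bF2 u) => m _ _; exact: measurable_funS m.
- by move=> x _; rewrite lee_fin.
Qed.

End bounded_integrals.

(** * Weighted AM-GM and Hoelder inequalities for finitely many factors *)

Section holder.
Context {R : realType}.

Lemma powR_sum (I : Type) (r : seq I) (P : pred I) (w : I -> R) (x : R) :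
  0 < x -> x `^ (\sum_(i <- r | P i) w i) = \prod_(i <- r | P i) x `^ w i.
Proof.
move=> x0; apply: (big_morph (powR x)) => [u v|]; last exact: powRr0.
by rewrite powRD//; apply/implyP => _; rewrite gt_eqF.
Qed.

(** Polya's argument: with [A] the weighted mean, [t <= exp (t - 1)] at [t = a i / A] bounds the
    normalised product by the exponential of a sum equal to 0. The case [A = 0] is treated apart. *)
Lemma weighted_AMGM (I : Type) (r : seq I) (P : pred I) (w a : I -> R) :
  (forall i, 0 <= w i) -> (forall i, 0 <= a i) ->
  \sum_(i <- r | P i) w i = 1 ->
  \prod_(i <- r | P i) a i `^ w i <= \sum_(i <- r | P i) w i * a i.
Proof.
move=> w0 a0 w1.
have prod_le b : (forall i, 0 <= b i) ->
    \prod_(i <- r | P i) b i `^ w i <= expR (\sum_(i <- r | P i) w i * (b i - 1)).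
  move=> b0; rewrite expR_sum; apply: ler_prod => i _; rewrite powR_ge0/= mulrC.
  rewrite expRM; apply: ge0_ler_powR => //; rewrite ?nnegrE ?expR_ge0//.
  by rewrite (le_trans _ (expR_ge1Dx _))// addrC subrK.
have : 0 <= \sum_(i <- r | P i) w i * a i.
  by apply: sumr_ge0 => i _; rewrite mulr_ge0.
rewrite le_eqVlt => /predU1P[A0|].
  rewrite -A0 le_eqVlt; apply/orP; left; apply/eqP.
  (* Unlike the value 1, being nonzero is what the induction needs: it survives the removal of a
     term of weight 0. *)
  have {}w1 : \sum_(i <- r | P i) w i != 0 by rewrite w1 oner_eq0.
  elim: r w1 A0 {prod_le} => [|i r IH]; first by rewrite !big_nil eqxx.
  rewrite !big_cons; case: ifP => // _ w1 /esym/eqP.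
  rewrite paddr_eq0 ?mulr_ge0 ?sumr_ge0//; last by move=> j _; exact: mulr_ge0.
  rewrite mulf_eq0 => /andP[/orP[/eqP wi0|/eqP ai0] /eqP/esym A0].
    by rewrite wi0 powRr0 mul1r IH//; move: w1; rewrite wi0 add0r.
  have [wi0|wi0] := eqVneq (w i) 0; last by rewrite ai0 powR0// mul0r.
  by rewrite wi0 powRr0 mul1r IH//; move: w1; rewrite wi0 add0r.
set A := \sum_(_ <- _ | _) _ => A0.
have A1 : A = \prod_(i <- r | P i) A `^ w i by rewrite -powR_sum// w1 powRr1// ltW.
have := prod_le (fun i => a i / A) (fun i => divr_ge0 (a0 i) (ltW A0)).
rewrite [X in expR X](_ : _ = 0); last first.
  under eq_bigr do rewrite mulrBr mulr1 mulrA.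
  by rewrite sumrB w1 -mulr_suml divff ?subrr// gt_eqF.
rewrite expR0 => H; rewrite [leRHS]A1.
rewrite (_ : \prod_(i <- r | P i) a i `^ w i =
    \prod_(i <- r | P i) (a i / A) `^ w i * \prod_(i <- r | P i) A `^ w i).
  by rewrite ler_piMl// prodr_ge0// => i _; exact: powR_ge0.
rewrite -big_split/=; apply: eq_bigr => i _.
by rewrite -powRM ?divr_ge0 ?(ltW A0) // divfK// gt_eqF.
Qed.

(** Pointwise AM-GM for the [h i / k i], with arbitrary positive scales [k i], gives [scaled];
    taking the integrals themselves as scales turns its last sum into the sum of the weights. The
    case distinctions deal with vanishing integrals. *)
Lemma itg_holder (m : nat) (P : pred 'I_m) (w : 'I_m -> R) (h : 'I_m -> R -> R)
    (a c : R) :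
  (forall i, 0 <= w i) -> \sum_(i | P i) w i = 1 -> (forall i, bmf (h i)) ->
  itg a c (fun t => \prod_(i | P i) h i t `^ w i) <=
  \prod_(i | P i) itg a c (h i) `^ w i.
Proof.
move=> w0 w1 bh; have h0 i t : 0 <= h i t by case: (bh i).
have I0 i : 0 <= itg a c (h i) by exact: itg_ge0.
have scaled (k : 'I_m -> R) : (forall i, 0 < k i) ->
    itg a c (fun t => \prod_(i | P i) h i t `^ w i) <=
    (\prod_(i | P i) k i `^ w i) * \sum_(i | P i) w i * (itg a c (h i) / k i).
  move=> k0.
  have bw i : bmf (fun t => w i * (h i t / k i)).
    by apply: bmfM; [exact: bmf_cst|apply: bmfM => //; apply: bmf_cst;
      rewrite invr_ge0 ltW].
  apply: (@le_trans _ _ (itg a c (fun t => (\prod_(i | P i) k i `^ w i) *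
      \sum_(i | P i) w i * (h i t / k i)))).
    apply: le_itg => [||t _].
    - by apply: bmf_prod => i; exact: bmf_powR.
    - apply: bmfM; last by apply: bmf_sum.
      by apply/bmf_cst/prodr_ge0 => i _; exact: powR_ge0.
    - rewrite [leLHS](_ : _ = (\prod_(i | P i) k i `^ w i) *
          \prod_(i | P i) (h i t / k i) `^ w i).
        apply: ler_wpM2l; first by apply/prodr_ge0 => i _; exact: powR_ge0.
        by apply: weighted_AMGM => // i; rewrite divr_ge0// ltW.
      rewrite -big_split/=; apply: eq_bigr => i _.
      by rewrite -powRM ?divr_ge0 ?(ltW (k0 i))// mulrC divfK// gt_eqF.
  rewrite itgZ; last exact: bmf_sum.
  rewrite itg_sum//; apply: ler_wpM2l.
    by apply/prodr_ge0 => i _; exact: powR_ge0.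
  apply: ler_sum => i _; rewrite itgZ.
    by under eq_itg do rewrite mulrC; rewrite itgZ// (mulrC (k i)^-1).
  by apply: bmfM => //; apply: bmf_cst; rewrite invr_ge0 ltW.
have [/existsP[i0 /andP[Pi0 /andP[wi0 /eqP Ii0]]]|] :=
    boolP [exists i, P i && ((0 < w i) && (itg a c (h i) == 0))].
  rewrite [leRHS](bigD1 i0)//= Ii0 powR0 ?mul0r; last by rewrite gt_eqF.
  apply/ler_addgt0Pl => e e0; rewrite addr0.
  (* The right side is 0 here. The scale at [i0] makes the weighted product of all scales equal to
     [e], and every scale is at least the corresponding integral, so the left side is at most
     [e]. *)
  pose C := \prod_(i | P i && (i != i0)) (itg a c (h i) + 1) `^ w i.
  have C0 : 0 < C by apply: prodr_gt0 => i _; rewrite powR_gt0// ltr_wpDl.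
  pose k i := if i == i0 then (e / C) `^ (w i0)^-1 else itg a c (h i) + 1.
  have k0 i : 0 < k i.
    by rewrite /k; case: ifP => _; [rewrite powR_gt0// divr_gt0|rewrite ltr_wpDl].
  apply: (le_trans (scaled k k0)).
  rewrite (bigD1 i0)//= {1}/k eqxx -powRrM mulVf ?gt_eqF//.
  rewrite powRr1 ?divr_ge0 ?(ltW e0) ?(ltW C0)//.
  under eq_bigr => i /andP[_ /negbTE ii0] do rewrite /k ii0.
  rewrite -/C divfK ?gt_eqF// ler_piMr ?(ltW e0)// -w1.
  apply: ler_sum => i _; rewrite ler_piMr// ler_pdivrMr// mul1r.
  rewrite /k; case: eqVneq => [->|_]; first by rewrite Ii0 powR_ge0.
  by rewrite lerDl.
rewrite negb_exists => /forallP Ip.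
(* The value 1 is a placeholder: under [P i] it occurs only with [w i = 0], where both powers are
   1. *)
pose k i := if itg a c (h i) == 0 then 1 else itg a c (h i).
have k0 i : 0 < k i by rewrite /k; case: eqVneq => // ?; rewrite lt_neqAle eq_sym I0 andbT.
apply: (le_trans (scaled k k0)).
rewrite (_ : \prod_(i | P i) k i `^ w i = \prod_(i | P i) itg a c (h i) `^ w i).
  rewrite ler_piMr//; first by apply/prodr_ge0 => i _; exact: powR_ge0.
  rewrite -w1; apply: ler_sum => i _; rewrite ler_piMr// ler_pdivrMr// mul1r.
  by rewrite /k; case: eqVneq => [->|].
apply: eq_bigr => i Pi; rewrite /k; case: eqVneq => // Ii.
have := Ip i; rewrite Pi Ii eqxx andbT/= -leNgt => wi0.
have -> : w i = 0 by apply/le_anti; rewrite wi0 w0.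
by rewrite !powRr0.
Qed.

End holder.

(** * Iterated marginals *)

Section marginals.
Context {R : realType} {n : nat}.
Local Notation T := (n.-tuple (measurableTypeR R)).
Implicit Types (F G : T -> R) (x : T) (i j : 'I_n) (s : seq 'I_n).

Definition upd x i (t : R) : T := [tuple if j == i then t else tnth x j | j < n].

Lemma tnth_upd x i t j : tnth (upd x i t) j = if j == i then t else tnth x j.
Proof. by rewrite tnth_mktuple. Qed.

Lemma upd_upd x i t u : upd (upd x i t) i u = upd x i u.
Proof. by apply: eq_from_tnth => j; rewrite !tnth_upd; case: eqP. Qed.

Lemma updC x i j t u : i != j -> upd (upd x i t) j u = upd (upd x j u) i t.
Proof.
move=> ij; apply: eq_from_tnth => k; rewrite !tnth_upd.
by case: (eqVneq k j) => [->|//]; rewrite eq_sym (negbTE ij).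
Qed.

Lemma upd_id x i : upd x i (tnth x i) = x.
Proof. by apply: eq_from_tnth => j; rewrite tnth_upd; case: eqP => [->|]. Qed.

Lemma measurable_upd i :
  measurable_fun setT (fun z : T * measurableTypeR R => upd z.1 i z.2).
Proof.
apply/measurable_fun_tnthP => j.
rewrite (_ : _ \o _ = if j == i then snd else (fun z => tnth z.1 j)); last first.
  by apply/funext => z /=; rewrite tnth_upd; case: eqP.
case: ifP => _ //.
exact: (measurableT_comp (measurable_tnth _)).
Qed.

Lemma measurable_upd_snd i x : measurable_fun setT (upd x i).
Proof.
exact: (measurableT_comp (measurable_upd i) (pair1_measurable x)).
Qed.

Lemma bmf_upd F x i : bmf F -> bmf (fun t => F (upd x i t)).
Proof. by move=> bF; apply: (bmf_comp (h := upd x i)) bF; exact: measurable_upd_snd. Qed.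

(** The integrated coordinate stays as an idle argument. All marginals thus live on the same space
    of n-tuples, and not depending on a coordinate is a proposition ([indep]) rather than a change
    of type. *)
Definition marg (a c : R) i F : T -> R := fun x => itg a c (fun t => F (upd x i t)).

Lemma bmf_marg a c i F : bmf F -> bmf (marg a c i F).
Proof.
move=> bF; apply: (bmf_itg (F := fun z => F (upd z.1 i z.2))).
by apply: (bmf_comp (h := fun z : T * R => upd z.1 i z.2)) bF; exact: measurable_upd.
Qed.

Lemma marg_indep a c i F x t : marg a c i F (upd x i t) = marg a c i F x.
Proof. by apply: eq_itg => u _; rewrite upd_upd. Qed.

Lemma margC a1 c1 a2 c2 i j F : bmf F -> i != j ->
  marg a1 c1 i (marg a2 c2 j F) = marg a2 c2 j (marg a1 c1 i F).
Proof.
move=> bF ij; apply/funext => x; rewrite /marg.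
rewrite (itg_swap _ _ _ _ (F := fun z => F (upd (upd x i z.1) j z.2)))/=.
  by apply: eq_itg => u _; apply: eq_itg => t _; rewrite updC.
apply: (bmf_comp (h := fun z : R * R => upd (upd x i z.1) j z.2)) bF.
apply: (measurableT_comp (measurable_upd j)
  (measurable_fun_pair (measurableT_comp (measurable_upd_snd i x) measurable_fst)
    measurable_snd)).
Qed.

Definition indep F i := forall x t, F (upd x i t) = F x.

Lemma indep_marg a c i j F : indep F j -> indep (marg a c i F) j.
Proof.
move=> Fj x t; have [->|ij] := eqVneq i j; first exact: marg_indep.
by apply: eq_itg => u _; rewrite updC 1?eq_sym// Fj.
Qed.

Variable b : R.

Definition margs s F : T -> R := foldr (marg (- b) b) F s.

Lemma bmf_margs s F : bmf F -> bmf (margs s F).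
Proof. by move=> bF; elim: s => //= i s; exact: bmf_marg. Qed.

Lemma margs_cat s1 s2 F : margs (s1 ++ s2) F = margs s1 (margs s2 F).
Proof. by rewrite /margs foldr_cat. Qed.

Lemma indep_margs s F j : indep F j -> indep (margs s F) j.
Proof. by move=> Fj; elim: s => //= i s; exact: indep_marg. Qed.

Lemma indep_margs_in s F j : j \in s -> indep (margs s F) j.
Proof.
elim: s => //= i s IH; rewrite inE; case: eqVneq => [-> _ x t|_ /=].
  exact: marg_indep.
by move=> /IH; exact: indep_marg.
Qed.

Lemma le_marg a c i F G x : bmf F -> bmf G -> (forall y, F y <= G y) ->
  marg a c i F x <= marg a c i G x.
Proof. by move=> bF bG FG; apply: le_itg => //; exact: bmf_upd. Qed.

Lemma le_margs s F G : bmf F -> bmf G -> (forall x, F x <= G x) ->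
  forall x, margs s F x <= margs s G x.
Proof.
by move=> bF bG FG; elim: s => //= i s IH x; apply: le_marg => //; exact: bmf_margs.
Qed.

Lemma margs_ge0 s F x : (forall x, 0 <= F x) -> 0 <= margs s F x.
Proof. by move=> F0; elim: s x => //= i s IH x; exact: itg_ge0. Qed.

Lemma marg_margsC a c i s F : bmf F -> i \notin s ->
  marg a c i (margs s F) = margs s (marg a c i F).
Proof.
move=> bF; elim: s => //= j s IH; rewrite inE negb_or => /andP[ij si].
by rewrite margC ?IH//; exact: bmf_margs.
Qed.

Lemma margsC s1 s2 F : bmf F -> margs s1 (margs s2 F) = margs s2 (margs s1 F).
Proof.
move=> bF; elim: s1 => //= i s1 ->; elim: s2 => //= j s2 IH.
have [<-|ij] := eqVneq i j; first by rewrite IH.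
by rewrite margC ?IH//; do 2 apply: bmf_margs.
Qed.

Lemma perm_margs s1 s2 F : bmf F -> perm_eq s1 s2 -> margs s1 F = margs s2 F.
Proof.
move=> bF; apply: (catCA_perm_subst (F := margs^~ F)) => u v w.
by rewrite !margs_cat margsC//; exact: bmf_margs.
Qed.

(* Finner's inequality; for w constant it is the uniform cover inequality of Bollobas and Thomason,
   and for c k = set0 it is Hoelder's inequality. *)
Lemma margs_prod_holder (m : nat) (w : 'I_m -> R) (c : 'I_m -> {set 'I_n})
    (H : 'I_m -> T -> R) s x :
  (forall k, 0 <= w k) -> (forall k, bmf (H k)) ->
  (forall k j, j \in c k -> indep (H k) j) ->
  (forall j, j \in s -> \sum_(k | j \notin c k) w k = 1) ->
  margs s (fun x => \prod_k H k x `^ w k) x <=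
  \prod_k margs [seq j <- s | j \notin c k] (H k) x `^ w k.
Proof.
move=> w0 bH Hc; elim: s x => [x _|j s IH x sw]; first exact: lexx.
have {}IH y := IH y (fun i si => sw i (mem_behead (s := j :: s) si)).
pose H' k := margs [seq j <- s | j \notin c k] (H k).
have bH' k : bmf (H' k) by exact: bmf_margs.
have bP (I : 'I_m -> T -> R) : (forall k, bmf (I k)) ->
    bmf (fun x => \prod_k I k x `^ w k).
  by move=> bI; apply: bmf_prod => k; exact: bmf_powR.
apply: (@le_trans _ _ (marg (- b) b j (fun x => \prod_k H' k x `^ w k) x)).
  by apply: le_marg => //; [apply/bmf_margs/bP|exact: bP].
(* Factors with [j \in c k] are constant in coordinate [j] and leave the integral; the weights of
   the others add up to 1 by [sw], as [itg_holder] requires. *)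
rewrite /marg (bigID [pred k | j \in c k])/=.
under eq_itg => t _.
  rewrite (bigID [pred k | j \in c k])/=.
  under eq_bigr => k kj do rewrite /H' (indep_margs _ (Hc k j kj)).
  over.
rewrite itgZ; last by apply: bmf_prod => k; apply: bmf_powR => //; exact: bmf_upd.
rewrite [X in _ <= X * _](_ : _ = \prod_(k | j \in c k) H' k x `^ w k); last first.
  by apply: eq_bigr => k ->.
apply: ler_wpM2l; first by apply: prodr_ge0 => k _; exact: powR_ge0.
rewrite [leRHS](_ : _ =
    \prod_(k | j \notin c k) itg (- b) b (fun t => H' k (upd x j t)) `^ w k).
  by apply: itg_holder => // [|k]; [apply: sw; rewrite mem_head|exact: bmf_upd].
by apply: eq_bigr => k ->.
Qed.

Definition upds x s (c : seq R) : T :=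
  foldl (fun y p => upd y p.1 p.2) x (zip s c).

Lemma tnth_upds_notin x s c j : j \notin s -> tnth (upds x s c) j = tnth x j.
Proof.
rewrite /upds; elim: s c x => [|i s IH] [|t c] x //=.
by rewrite inE negb_or => /andP[ij /IH ->]; rewrite tnth_upd (negbTE ij).
Qed.

Lemma tnth_upds x s c k i0 : uniq s -> (size s <= size c)%N -> (k < size s)%N ->
  tnth (upds x s c) (nth i0 s k) = nth 0 c k.
Proof.
rewrite /upds; elim: s c x k => [|i s IH] [|t c] x [|k]//=.
  by move=> /andP[si _] _ _; rewrite tnth_upds_notin// tnth_upd eqxx.
by move=> /andP[_ us] sc ks; exact: IH.
Qed.

End marginals.

(** * Volumes and projected volumes as iterated marginals *)

Section volume_marginals.
Context {R : realType} {n : nat}.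
Local Notation T := (n.-tuple (measurableTypeR R)).
Implicit Types (x : T) (i j : 'I_n) (s : seq 'I_n).

Lemma margs_eq0 b s (F : T -> R) x :
  (forall y, (forall j, j \notin s -> tnth y j = tnth x j) -> F y = 0) ->
  margs b s F x = 0.
Proof.
elim: s x => [x F0|i s IH x F0]; first exact: F0.
rewrite /margs/= /marg; under eq_itg => t _.
  rewrite -/(margs b s F) IH; first over.
  move=> y yx; apply: F0 => j; rewrite inE negb_or => /andP[ji js].
  by rewrite yx// tnth_upd (negbTE ji).
by rewrite /itg Rintegral_cst// mul0r.
Qed.

(** The product measure and [margs] peel off coordinates in the same order. Integrating over
    [[- b, b]] instead of the line loses nothing, as the sections of [A] beyond it are empty. *)
Lemma lebesgue_tuple_upds b s k x (A : set T) :
  size s = k -> measurable A -> uniq s ->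
  (forall y j, A y -> j \in s -> - b <= tnth y j <= b) ->
  lebesgue_tuple [set c : k.-tuple (measurableTypeR R) | A (upds x s c)] =
  (margs b s \1_A x)%:E.
Proof.
move=> <- mA {k}; elim: s x => [|i s IH] x.
  move=> _ _; rewrite /= diracE indicE /=; congr (_%:R%:E).
rewrite cons_uniq => /andP[si us] Ab.
have {}IH y := IH y us (fun z j Az js => Ab z j Az (mem_behead (s := i :: s) js)).
have bA : bmf (margs b s \1_A) by apply: bmf_margs; exact: bmf_indic.
rewrite /= /pushforward /product_measure1 EFin_itg; last exact: bmf_upd.
rewrite -/(margs b s _) integral_itv_patch; apply: eq_integral => t _ /=.
rewrite (_ : xsection _ _ =
    [set c : (size s).-tuple (measurableTypeR R) | A (upds (upd x i t) s c)]).
  rewrite IH indicE; have [tb|tb] := boolP (t \in _); first by rewrite mulr1.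
  rewrite mulr0 margs_eq0// => y yx; rewrite indicE; have [|//] := boolP (y \in A).
  rewrite inE => /Ab /(_ (mem_head _ _)); rewrite yx// tnth_upd eqxx => tb'.
  by move/negP: tb; rewrite inE/= in_itv/=.
by rewrite predeqE => c; rewrite /xsection/=; split; rewrite inE.
Qed.

(* The cylinder over the projection of K onto coord_subspace tau. *)
Definition cyl (tau : {set 'I_n}) (K : set 'rV[R]_n) : set T :=
  [set x | exists2 z, K z & forall i, i \notin tau -> z 0 i = tnth x i].

(** With no free coordinate the cylinder is [K] itself, read as a set of tuples. The base point [x]
    is arbitrary because every coordinate is integrated out. *)
Lemma volume_margs b (K : set 'rV[R]_n) x : measurable (cyl finset.set0 K) ->
  (forall z j, K z -> - b <= z 0 j <= b) ->
  volume K = (margs b (enum 'I_n) \1_(cyl finset.set0 K) x)%:E.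
Proof.
move=> mA Kb; rewrite -(@lebesgue_tuple_upds b _ n)//; last 3 first.
- by rewrite size_enum_ord.
- exact: enum_uniq.
- by move=> y j [z Kz zy] _; rewrite -zy ?inE//; exact: Kb.
rewrite /volume; congr lebesgue_tuple; rewrite predeqE => c /=.
have upc i : tnth (upds x (enum 'I_n) c) i = tnth c i.
  rewrite (tnth_nth 0 c) -[in LHS](nth_ord_enum i i) tnth_upds ?enum_uniq//.
  - by rewrite size_enum_ord size_tuple.
  - by rewrite size_enum_ord.
split=> [Kc|[z Kz zc]].
  by exists (\row_i tnth c i) => // i _; rewrite mxE upc.
rewrite (_ : \row_i _ = z)//; apply/rowP => i.
by rewrite mxE zc ?inE// upc.
Qed.

(** Again [x] is arbitrary: its coordinates in [tau] are free in the cylinder, the others are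
    integrated out. *)
Lemma coord_volume_margs b (tau : {set 'I_n}) (K : set 'rV[R]_n) x :
  measurable (cyl tau K) ->
  (forall z j, K z -> - b <= z 0 j <= b) ->
  coord_volume tau (orthoproj (coord_subspace tau) @` K) =
  (margs b (enum (~: tau)) \1_(cyl tau K) x)%:E.
Proof.
move=> mA Kb; rewrite -(@lebesgue_tuple_upds b _ #|~: tau|)//; last 3 first.
- by rewrite -cardE.
- exact: enum_uniq.
- by move=> y j [z Kz zy]; rewrite mem_enum inE => jt; rewrite -zy//; exact: Kb.
rewrite /coord_volume /volume; congr lebesgue_tuple; rewrite predeqE => c /=.
have upc k : tnth (upds x (enum (~: tau)) c) (enum_val k) = tnth c k.
  rewrite (tnth_nth 0 c) /enum_val tnth_upds ?enum_uniq//.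
  - by rewrite -cardE size_tuple.
  - by rewrite -cardE.
split=> [[z Kz zc]|[z Kz zc]]; exists z => //.
  move=> i it; have it' : i \in ~: tau by rewrite inE.
  have := congr1 (fun v : 'rV[R]_n => v 0 i) zc.
  rewrite orthoproj_coordE mxE (negbTE it) => ->.
  by rewrite -(enum_rankK_in it' it') coord_isometryE mxE upc.
apply/rowP => i; rewrite orthoproj_coordE mxE; case: ifPn => it.
  by rewrite ((coord_subspaceP _ _).1 (coord_isometry_in _) i it).
have it' : i \in ~: tau by rewrite inE.
by rewrite zc// -(enum_rankK_in it' it') coord_isometryE mxE upc.
Qed.

End volume_marginals.

(** * Measurability and boundedness for compact sets *)

Section compact_cylinders.
Context {R : realType} {n : nat}.
Local Notation T := (n.-tuple (measurableTypeR R)).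

(** Bridge from the norm topology of row vectors to the product sigma-algebra of tuples: an open set
    is the union of the countably many rational boxes inside it. *)
Lemma open_tuple_measurable (U : set 'rV[R]_n) : open U ->
  measurable [set x : T | U (\row_i tnth x i)].
Proof.
move=> oU.
pose box (p : {ffun 'I_n -> rat} * nat) : set T :=
  [set x | forall i, `|ratr (p.1 i) - tnth x i| < p.2.+1%:R^-1].
pose F p := if `[< box p `<=` [set x : T | U (\row_i tnth x i)] >]
  then box p else set0.
rewrite (_ : [set x | _] = \bigcup_p F p).
  apply: countable_bigcupT_measurable => [|p]; [exact: countableP|rewrite /F].
  case: ifP => _; last exact: measurable0.
  apply: (measurable_box (A := fun i => [set t : R | `|ratr (p.1 i) - t| < p.2.+1%:R^-1])).
  move=> i; rewrite (_ : [set t | _] =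
    `](ratr (p.1 i) - p.2.+1%:R^-1), (ratr (p.1 i) + p.2.+1%:R^-1)[%classic)//.
  by apply/seteqP; split => t /=; rewrite in_itv/= ltr_distlC.
rewrite predeqE => x; split; last first.
  by move=> [p _]; rewrite /F; case: asboolP => // pU /pU.
move=> Ux; have := oU; rewrite openE => /(_ _ Ux) /nbhs_ballP[e /= e0 eU].
(* A box of this half-width that contains [x] has all its points within [e] of [x]. *)
have [k ke] : exists k : nat, k.+1%:R^-1 < e / 2.
  have /ltr_add_invr[k] : 0 < e / 2 by rewrite divr_gt0.
  by rewrite add0r => ?; exists k.
have qx (i : 'I_n) : exists q : rat, `|ratr q - tnth x i| < k.+1%:R^-1.
  have /rat_in_itvoo[q] : tnth x i - k.+1%:R^-1 < tnth x i + k.+1%:R^-1.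
    by rewrite ltrD2l gtrN// invr_gt0.
  by rewrite in_itv/= => qi; exists q; rewrite ltr_distl.
exists ([ffun i => projT1 (cid (qx i))], k) => //.
have bx : box ([ffun i => projT1 (cid (qx i))], k) x.
  by move=> i /=; rewrite ffunE; case: cid.
rewrite /F; case: asboolP => //; case => y yb /=; apply: eU.
split=> // u v; rewrite !mxE /ball/=.
rewrite -(subrK (ratr (projT1 (cid (qx v)))) (tnth x v)) -addrA.
apply: (le_lt_trans (ler_normD _ _)); rewrite (splitr e) ltrD//.
  by apply: lt_trans ke; have := bx v; rewrite /= ffunE distrC.
by apply: lt_trans ke; have := yb v; rewrite /= ffunE.
Qed.

(** A projection of a Borel set may fail to be Borel; that of a compact set is compact, hence
    closed, so the cylinder is the complement of an open set. *)
Lemma compact_cyl_measurable (tau : {set 'I_n}) (K : set 'rV[R]_n) :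
  compact K -> measurable (cyl tau K).
Proof.
move=> cK.
pose P (y : 'rV[R]_n) : 'rV[R]_n := \row_i (if i \in tau then 0 else y 0 i).
have cP : continuous P.
  move=> y A /nbhs_ballP[e /= e0 eA]; apply/nbhs_ballP; exists e => //= z [_ yz].
  apply: eA.
  split=> // i j; rewrite !mxE; case: ifP => _; first exact: ballxx.
  exact: yz.
have cPK : closed (P @^-1` (P @` K)).
  apply: closed_comp => [y _|]; first exact: cP.
  apply: compact_closed; first exact: norm_hausdorff.
  by apply: continuous_compact => //; exact: continuous_subspaceT.
rewrite (_ : cyl tau K = ~` [set x : T | (~` (P @^-1` (P @` K))) (\row_i tnth x i)]).
  by apply/measurableC; apply: open_tuple_measurable; exact: closed_openC.
rewrite predeqE => x /=; rewrite notK; split=> -[z Kz zx]; exists z => //.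
  by apply/rowP => i; rewrite !mxE; case: ifPn => // /zx.
move=> i it; have := congr1 (fun v : 'rV[R]_n => v 0 i) zx.
by rewrite !mxE (negbTE it).
Qed.

Lemma compact_box (K : set 'rV[R]_n) : compact K ->
  exists2 b : R, 0 <= b & forall z j, K z -> - b <= z 0 j <= b.
Proof.
move=> /compact_bounded[M [_ KM]]; exists (`|M| + 1); first by rewrite addr_ge0.
move=> z j Kz; rewrite -ler_norml.
have : `|z| <= `|M| + 1.
  by apply: (KM (`|M| + 1)) => //; rewrite (le_lt_trans (ler_norm M))// ltrDl.
apply: le_trans; rewrite (_ : `|z| = mx_norm z)// mx_normrE.
by rewrite (le_trans _ (le_bigmax _ _ (0, j)))//.
Qed.

End compact_cylinders.

(** * Brunn's theorem *)

Section borell_brascamp_lieb.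
Context {R : realType}.
Local Notation mu := (@lebesgue_measure R).

Definition rt (k : nat) (a : R) : R := a `^ k%:R^-1.

Lemma rt_ge0 k a : 0 <= rt k a. Proof. exact: powR_ge0. Qed.

Lemma rtK k a : (0 < k)%N -> 0 <= a -> rt k a ^+ k = a.
Proof.
move=> k0 a0; rewrite -powR_mulrn ?rt_ge0// -powRrM mulVf ?powRr1//.
by rewrite pnatr_eq0 -lt0n.
Qed.

Lemma ler_rt k a b : 0 <= a -> a <= b -> rt k a <= rt k b.
Proof.
by move=> a0 ab; apply: ge0_ler_powR; rewrite ?invr_ge0 ?ler0n// ?nnegrE// (le_trans a0).
Qed.

Lemma exprK_rt k a : (0 < k)%N -> 0 <= a -> rt k (a ^+ k) = a.
Proof.
move=> k0 a0; rewrite /rt -powR_mulrn// -powRrM divff ?powRr1//.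
by rewrite pnatr_eq0 -lt0n.
Qed.

Lemma rt0 a : rt 0 a = 1.
Proof. by rewrite /rt invr0 powRr0. Qed.

(** Two-term Hoelder inequality with the conjugate exponents [(k+1)/k] and [k+1]; for [k = 0] both
    sides agree. It is the source of the passage from k-th to (k+1)-th roots. *)
Lemma rt_mean_le k (th al be I J : R) : 0 < th < 1 -> 0 <= al -> 0 <= be ->
  0 <= I -> 0 <= J ->
  (1 - th) * rt k.+1 (al ^+ k * I) + th * rt k.+1 (be ^+ k * J) <=
  rt k.+1 (((1 - th) * al + th * be) ^+ k * ((1 - th) * I + th * J)).
Proof.
move=> /andP[th0 th1] al0 be0 I0 J0.
have t1 : 0 <= 1 - th by rewrite subr_ge0 ltW.
have t0 := ltW th0.
case: k => [|k].
  by rewrite !expr0 !mul1r /rt !invr1 !powRr1// addr_ge0// mulr_ge0.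
pose p : R := k.+2%:R / k.+1%:R; pose q : R := k.+2%:R.
have p0 : 0 < p by rewrite divr_gt0.
have pV : p^-1 = k.+1%:R / q by rewrite invf_div.
have pq : p^-1 + q^-1 = 1.
  by rewrite pV -[X in _ + X]mul1r -mulrDl natr1 divff// pnatr_eq0.
have E c x y : 0 <= c -> 0 <= x -> 0 <= y ->
    c * rt k.+2 (x ^+ k.+1 * y) = (c * x) `^ p^-1 * (c * y) `^ q^-1.
  move=> c0 x0 y0; rewrite !powRM// mulrACA -powRD; last first.
    by rewrite pq oner_eq0.
  rewrite pq powRr1// /rt powRM ?exprn_ge0//; congr (_ * (_ * _)).
  by rewrite -powR_mulrn// -powRrM pV.
have K x r : 0 <= x -> 0 < r -> (x `^ r^-1) `^ r = x.
  by move=> x0 r0; rewrite -powRrM mulVf ?powRr1// gt_eqF.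
rewrite !E//.
apply: (le_trans (@hoelder2 _ _ _ _ _ p q _ _ _ _ _ _ _)); rewrite ?powR_ge0//.
rewrite !K ?mulr_ge0//.
have := E 1 ((1 - th) * al + th * be) ((1 - th) * I + th * J).
rewrite !mul1r => -> //; by rewrite addr_ge0// mulr_ge0.
Qed.

Lemma itg_indic_diam (a c L : R) (A : set R) : measurable A -> A !=set0 ->
  A `<=` `[a, c] ->
  (forall u v, A u -> A v -> v - u <= L) -> itg a c \1_A <= L.
Proof.
move=> mA A0 Aac AL.
have lbA : has_inf A by split=> //; exists a => u /Aac/=; rewrite in_itv/= => /andP[].
have L0 : 0 <= L by case: A0 => u Au; rewrite -(subrr u); exact: AL.
rewrite -lee_fin EFin_itg; last exact: bmf_indic.
rewrite integral_indic//; apply: (@le_trans _ _ (mu `[inf A, inf A + L])).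
  apply: le_measure; rewrite ?inE//=; first exact: measurableI.
  move=> u [Au _] /=; rewrite in_itv/=; apply/andP; split.
    exact: (inf_lbound lbA.2).
  rewrite -lerBlDr; apply: lb_le_inf => // v Av.
  by rewrite lerBlDr addrC -lerBlDr; exact: AL.
rewrite lebesgue_measure_itv/= lte_fin; case: ifP => _; last by rewrite lee_fin.
by rewrite -EFinD lee_fin addrAC subrr add0r.
Qed.

Lemma itg_indic_ge (a c u v : R) (A : set R) : measurable A -> is_interval A ->
  A `<=` `[a, c] -> A u -> A v -> v - u <= itg a c \1_A.
Proof.
move=> mA iA Aac Au Av; have [uv|vu] := leP u v; last first.
  apply: (@le_trans _ _ 0); first by rewrite subr_le0 ltW.
  by apply: itg_ge0 => t; rewrite indicE.
rewrite -lee_fin EFin_itg; last exact: bmf_indic.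
rewrite integral_indic//; apply: (@le_trans _ _ (mu `[u, v])).
  rewrite lebesgue_measure_itv/= lte_fin; case: ltrP => [_|vu].
    by rewrite -EFinD.
  by rewrite lee_fin subr_le0.
apply: le_measure; rewrite ?inE//=; first exact: measurableI.
move=> t /=; rewrite in_itv/= => uvt; have At : A t by exact: (iA u v).
by split => //; have := Aac _ At.
Qed.

(** [A] and [B] enter through their diameters: two points of each give two mixed points of the
    interval [C], whose distance bounds the length of [C] from below. *)
Lemma itg_indic_mean (a c th : R) (A B C : set R) : 0 < th < 1 ->
  measurable A -> measurable B -> measurable C ->
  A `<=` `[a, c] -> B `<=` `[a, c] -> C `<=` `[a, c] ->
  A !=set0 -> B !=set0 -> is_interval C ->
  (forall u v, A u -> B v -> C ((1 - th) * u + th * v)) ->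
  (1 - th) * itg a c \1_A + th * itg a c \1_B <= itg a c \1_C.
Proof.
move=> /andP[th0 th1] mA mB mC Aac Bac Cac A0 B0 iC ABC.
have t1 : 0 < 1 - th by rewrite subr_gt0.
rewrite addrC -lerBrDr mulrC -ler_pdivlMr//; apply: itg_indic_diam => // v1 v2 Bv1 Bv2.
rewrite ler_pdivlMr// lerBrDl -lerBrDr mulrC -ler_pdivlMr//.
apply: itg_indic_diam => // u1 u2 Au1 Au2.
rewrite ler_pdivlMr// lerBrDr.
have := itg_indic_ge mC iC Cac (ABC _ _ Au1 Bv1) (ABC _ _ Au2 Bv2).
by apply: le_trans; rewrite le_eqVlt; apply/orP; left; apply/eqP; ring.
Qed.

End borell_brascamp_lieb.

(** * The one-dimensional Borell-Brascamp-Lieb inequality *)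

Section one_dimensional_step.
Context {R : realType}.

Lemma itg_level (s x : R) : 0 <= s -> 0 <= x ->
  s * itg 0 1 \1_([set r : R | r * s <= x]) = Num.min s x.
Proof.
rewrite le_eqVlt => /predU1P[<- x0|s0 x0].
  by rewrite mul0r; apply/esym; apply/min_idPl.
have -> : \1_([set r : R | r * s <= x]) = \1_(`]-oo, x / s]) :> (R -> R).
  congr indic; apply/seteqP; split => r /=; rewrite in_itv/= ler_pdivlMr//.
apply: EFin_inj; rewrite EFinM EFin_itg; last exact: bmf_indic.
rewrite integral_indic// (_ : _ `&` _ = `[0, Num.min 1 (x / s)]%classic); last first.
  apply/seteqP; split => r /=; rewrite !in_itv/= le_min.
    by move=> [-> /andP[-> ->]].
  by move=> /and3P[-> -> ->].
rewrite /= lebesgue_measure_itv/= lte_fin lt_min ltr01/= -EFinD subr0.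
case: ifPn => [_|].
  rewrite -EFinM; congr (_%:E).
  by rewrite minr_pMr ?(ltW s0)// mulr1 mulrCA divff ?mulr1// gt_eqF.
rewrite -leNgt pmulr_lle0 ?invr_gt0// => x_le0.
have -> : x = 0 by apply/le_anti; rewrite x0 x_le0.
by rewrite mule0 (min_idPr (ltW s0)).
Qed.

Definition level (A : set R) (f : R -> R) (s r : R) : set R :=
  [set t | A t /\ r * s <= f t].

Lemma level_measurable (A : set R) (f : R -> R) s r : measurable A -> bmf f ->
  measurable (level A f s r).
Proof.
move=> mA [mf _ _]; apply: measurableI => //.
by rewrite -[X in measurable X]setTI; apply: measurable_fun_le.
Qed.

(** Levels are measured as proportions [r] of a height [s], so that functions of different heights
    can be compared at the same [r]. The minimum is [f] itself once [s] bounds [f]. *)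
Lemma layer_cake (a c s : R) (A : set R) (f : R -> R) : measurable A -> bmf f ->
  0 <= s -> (forall t, ~ A t -> f t = 0) ->
  s * itg 0 1 (fun r => itg a c \1_(level A f s r)) =
  itg a c (fun t => Num.min s (f t)).
Proof.
move=> mA bf s0 fA; have [mf f0 _] := bf.
pose S : set (R * R) := [set z | A z.1 /\ z.2 * s <= f z.1].
have mS : measurable S.
  apply: measurableI.
    by rewrite -[X in measurable X]setTI; exact: measurable_fst.
  rewrite -[X in measurable X]setTI; apply: measurable_fun_le => //.
    by apply: measurable_funM => //; exact: measurable_snd.
  by apply: measurableT_comp => //; exact: measurable_fst.
have bS : bmf (\1_S : R * R -> R) by exact: bmf_indic.
have swapped := itg_swap a c 0 1 bS.
have bSr : bmf (fun r => itg a c (fun t => \1_S (t, r))).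
  apply: (bmf_itg (F := fun z : R * R => \1_S (z.2, z.1))).
  by apply: (bmf_comp (h := fun z : R * R => (z.2, z.1))) bS; exact: measurable_swap.
transitivity (s * itg 0 1 (fun r => itg a c (fun t => \1_S (t, r)))) => //.
rewrite -swapped -itgZ; last exact: bmf_itg.
clear swapped bSr.
apply: eq_itg => t _; rewrite -(itg_level s0 (f0 t)).
have [At|At] := pselect (A t).
  congr (_ * _); apply: eq_itg => r _.
  rewrite !indicE; congr ((nat_of_bool _)%:R); apply/idP/idP; rewrite !inE.
    by case.
  by split.
rewrite (itg_level s0 (f0 t)) (fA _ At) (min_idPr s0).
rewrite (@eq_itg _ _ _ _ (fun=> 0)); first by rewrite itg_cst// mul0r mulr0.
move=> r _; rewrite indicE; case: (boolP (_ \in _)) => //.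
by rewrite inE => -[].
Qed.

(** Supplies the nonempty levels required by [itg_indic_mean]; [r] stays below 1 since the supremum
    may not be attained. Taking the supremum of the roots lets the heights of two functions mix
    linearly. *)
Lemma level_sup k (D : set R) (e : R -> R) : D !=set0 -> bmf e ->
  (forall t, ~ D t -> e t = 0) -> (forall t, D t -> e t = rt k (e t) ^+ k) ->
  exists2 al, 0 <= al & (forall t, e t <= al ^+ k) /\
    forall r, 0 < r < 1 -> exists2 t, D t & r * al ^+ k <= e t.
Proof.
move=> D0 be eD ek; have [_ e0 [M eM]] := be.
pose E := [set rt k (e t) | t in D].
have sE : has_sup E.
  split; first by case: D0 => t Dt; exists (rt k (e t)), t.
  by exists (rt k M) => _ [t _ <-]; exact: ler_rt.
have al0 : 0 <= sup E.
  case: D0 => t Dt; apply: le_trans (rt_ge0 k (e t)) _.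
  by apply: (sup_ubound sE.2); exists t.
exists (sup E) => //; split=> [t|r /andP[r0 r1]].
  have [Dt|/eD ->] := pselect (D t); last exact: exprn_ge0.
  rewrite ek//; apply: lerXn2r; rewrite ?nnegrE ?rt_ge0//.
  by apply: (sup_ubound sE.2); exists t.
(* For [k = 0] the function is 1 on [D], so any point of [D] reaches level [r]. *)
have [k0|k0] := posnP k.
  by case: D0 => t Dt; exists t => //; rewrite ek// k0 !expr0 mulr1 ltW.
have [al_0|al_gt0] := eqVneq (sup E) 0.
  by case: D0 => t Dt; exists t => //; rewrite al_0 expr0n gtn_eqF// mulr0.
have {}al_gt0 : 0 < sup E by rewrite lt_neqAle eq_sym al_gt0.
have rr : rt k r < 1.
rewrite (_ : 1 = 1 `^ k%:R^-1); last by rewrite powR1.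
  by apply: gt0_ltr_powR; rewrite ?nnegrE ?invr_gt0 ?ltr0n ?(ltW r0).
have : rt k r * sup E < sup E by rewrite gtr_pMl.
move=> /(sup_gt sE.1)[_ [t Dt <-]] /ltW rt_le; exists t => //.
rewrite [leRHS]ek// -[r](@rtK _ k) ?(ltW r0)// -exprMn.
by apply: lerXn2r; rewrite ?nnegrE ?mulr_ge0 ?rt_ge0.
Qed.

(* Comparing the levels {f >= r al^k} and {g >= r be^k}, where al^k and be^k are the suprema of
   f and g, with the level r ka^k of h reduces the claim to the one-dimensional Brunn-Minkowski inequality
   at each r.  Only intervals occur as levels, so that case is elementary. *)
Lemma itg_BBL k (a c th : R) (A B C : set R) (f g h : R -> R) :
  0 < th < 1 -> bmf f -> bmf g -> bmf h ->
  is_interval A -> is_interval B -> is_interval C ->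
  A `<=` `[a, c] -> B `<=` `[a, c] -> C `<=` `[a, c] ->
  A !=set0 -> B !=set0 ->
  (forall t, ~ A t -> f t = 0) -> (forall t, ~ B t -> g t = 0) ->
  (forall t, ~ C t -> h t = 0) ->
  (forall t, A t -> f t = rt k (f t) ^+ k) ->
  (forall t, B t -> g t = rt k (g t) ^+ k) ->
  (forall t, C t -> h t = rt k (h t) ^+ k) ->
  (forall r, is_interval [set t | C t /\ r <= h t]) ->
  (forall u v, A u -> B v -> C ((1 - th) * u + th * v) /\
    (1 - th) * rt k (f u) + th * rt k (g v) <= rt k (h ((1 - th) * u + th * v))) ->
  (1 - th) * rt k.+1 (itg a c f) + th * rt k.+1 (itg a c g) <=
  rt k.+1 (itg a c h).
Proof.
move=> th01 bf bg bh iA iB iC Aac Bac Cac A0 B0 fA gB hC fk gk hk ih ABC.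
have /andP[th0 th1] := th01; have t1 : 0 < 1 - th by rewrite subr_gt0.
have mA := is_interval_measurable iA.
have mB := is_interval_measurable iB.
have mC := is_interval_measurable iC.
have [al al0 [fal Alev]] := level_sup A0 bf fA fk.
have [be be0 [gbe Blev]] := level_sup B0 bg gB gk.
pose ka := (1 - th) * al + th * be.
have ka0 : 0 <= ka by rewrite addr_ge0// mulr_ge0// ltW.
pose I := itg 0 1 (fun r => itg a c \1_(level A f (al ^+ k) r)).
pose J := itg 0 1 (fun r => itg a c \1_(level B g (be ^+ k) r)).
have itg_ind0 (D : set R) : 0 <= itg a c \1_D by apply: itg_ge0 => t; rewrite indicE.
have I0 : 0 <= I by exact: itg_ge0.
have J0 : 0 <= J by exact: itg_ge0.
have bmin s e : 0 <= s -> bmf e -> bmf (fun t : R => Num.min s (e t)).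
  move=> s0 [me e0 _]; split.
  - exact: measurable_minr.
  - by move=> t; rewrite le_min s0 e0.
  - by exists s => t; rewrite ge_min lexx.
have blev (D : set R) e s : measurable D -> bmf e ->
    bmf (fun r => itg a c \1_(level D e s r)).
  move=> mD [me e0 _].
  pose S : set (R * R) := [set z | D z.2 /\ z.1 * s <= e z.2].
  have mS : measurable S.
    apply: measurableI.
      by rewrite -[X in measurable X]setTI; exact: measurable_snd.
    rewrite -[X in measurable X]setTI; apply: measurable_fun_le => //.
      by apply: measurable_funM => //; exact: measurable_fst.
    by apply: measurableT_comp => //; exact: measurable_snd.
  rewrite (_ : (fun r => _) = fun r => itg a c (fun t => \1_S (r, t))).
    by apply: bmf_itg; exact: bmf_indic.
  by [].
have hL : ka ^+ k * ((1 - th) * I + th * J) <= itg a c h.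
  (* [ka ^+ k] need not bound [h]; truncating there only decreases the integral. *)
  apply: (@le_trans _ _ (itg a c (fun t => Num.min (ka ^+ k) (h t)))); last first.
    apply: le_itg => [||t _]; [by apply: bmin => //; exact: exprn_ge0|by []|].
    by rewrite ge_min lexx orbT.
  rewrite -(layer_cake a c mC bh) ?exprn_ge0//.
  apply: ler_wpM2l; first exact: exprn_ge0.
  rewrite /I /J -(itgZ _ _ _ (blev A f (al ^+ k) mA bf)).
  rewrite -(itgZ _ _ _ (blev B g (be ^+ k) mB bg)).
  rewrite -itgD; last 2 first.
  - by apply: bmfM; [exact/bmf_cst/ltW|exact: blev].
  - by apply: bmfM; [exact/bmf_cst/ltW|exact: blev].
  apply: le_itg => [||r r01].
  - by apply: bmfD; apply: bmfM; (try exact: blev); exact/bmf_cst/ltW.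
  - exact: blev.
  apply: itg_indic_mean => //; try exact: level_measurable.
  - by move=> t [/Aac].
  - by move=> t [/Bac].
  - by move=> t [/Cac].
  - by have [t At rt_le] := Alev r r01; exists t.
  - by have [t At rt_le] := Blev r r01; exists t.
  - exact: ih.
  move=> u v [Au ru] [Bv rv]; have [Cuv hle] := ABC u v Au Bv.
  split=> //; rewrite hk//.
  have /andP[r0 r1] := r01.
  have [k0|k0] := posnP k; first by rewrite k0 !expr0 mulr1 ltW.
  (* After taking roots the two levels are [rt k r * al] and [rt k r * be], whose mean is
     [rt k r * ka]. *)
  have base s e : 0 <= s -> 0 <= e -> r * s ^+ k <= e -> rt k r * s <= rt k e.
    move=> s0 e0 le; rewrite -[_ * s](@exprK_rt _ k) ?mulr_ge0 ?rt_ge0//.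
    by apply: ler_rt; rewrite exprMn rtK ?(ltW r0)// ?mulr_ge0 ?exprn_ge0 ?(ltW r0).
  rewrite -[r](@rtK _ k) ?(ltW r0)// -exprMn.
  apply: lerXn2r; rewrite ?nnegrE ?mulr_ge0 ?rt_ge0//.
  apply: le_trans hle; rewrite /ka mulrDr; apply: lerD; rewrite mulrCA;
    (apply: ler_wpM2l; first exact: ltW); apply: base => //.
  - by case: bf.
  - by case: bg.
have fI : itg a c f = al ^+ k * I.
  rewrite layer_cake ?exprn_ge0//; apply: eq_itg => t _.
  by apply/esym; apply/min_idPr.
have gJ : itg a c g = be ^+ k * J.
  rewrite layer_cake ?exprn_ge0//; apply: eq_itg => t _.
  by apply/esym; apply/min_idPr.
rewrite fI gJ; apply: (le_trans (rt_mean_le k th01 al0 be0 I0 J0)).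
apply: ler_rt; last exact: hL.
exact: mulr_ge0 (exprn_ge0 k ka0)
  (addr_ge0 (mulr_ge0 (ltW t1) I0) (mulr_ge0 (ltW th0) J0)).
Qed.

End one_dimensional_step.

(** * Concavity of roots of marginals *)

Section brunn.
Context {R : realType} {n : nat}.
Local Notation T := (n.-tuple (measurableTypeR R)).
Implicit Types (x y : T) (i j : 'I_n) (s : seq 'I_n) (S : set T) (F : T -> R).

Definition mix (th : R) x y : T :=
  [tuple (1 - th) * tnth x i + th * tnth y i | i < n].

Lemma tnth_mix th x y i : tnth (mix th x y) i = (1 - th) * tnth x i + th * tnth y i.
Proof. by rewrite tnth_mktuple. Qed.

Lemma mix_upd th x y i u v :
  mix th (upd x i u) (upd y i v) = upd (mix th x y) i ((1 - th) * u + th * v).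
Proof.
by apply: eq_from_tnth => j; rewrite !(tnth_mix, tnth_upd); case: eqP.
Qed.

(* F^(1/k) is concave on the convex set S, and F vanishes outside S.
   For k = 0 the second clause says that F = 1 on S, since rt 0 a = 1. *)
Definition kconc k S F := [/\ forall x, ~ S x -> F x = 0,
  forall x, S x -> F x = rt k (F x) ^+ k
  & forall x y th, S x -> S y -> 0 < th < 1 -> S (mix th x y) /\
    (1 - th) * rt k (F x) + th * rt k (F y) <= rt k (F (mix th x y))].

Lemma kconc_indic S :
  (forall x y th, S x -> S y -> 0 < th < 1 -> S (mix th x y)) ->
  kconc 0 S (\1_S).
Proof.
move=> cS; split=> [x Sx|x Sx|x y th Sx Sy th01].
- by rewrite indicE; case: (boolP (x \in S)) => //; rewrite inE.
- by rewrite indicE mem_set.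
- by split; [exact: cS|rewrite !rt0 !mulr1 subrK].
Qed.

Lemma convex_interval (A : set R) :
  (forall u v th, A u -> A v -> 0 < th < 1 -> A ((1 - th) * u + th * v)) ->
  is_interval A.
Proof.
move=> cA u v Au Av w /andP[]; rewrite le_eqVlt => /predU1P[<- //|uw].
rewrite le_eqVlt => /predU1P[-> //|wv].
have uv : 0 < v - u by rewrite subr_gt0 (lt_trans uw).
rewrite (_ : w = (1 - (w - u) / (v - u)) * u + (w - u) / (v - u) * v).
  apply: cA => //; apply/andP; split; first by rewrite divr_gt0// subr_gt0.
  by rewrite ltr_pdivrMr// mul1r ltrD2r.
by field; rewrite gt_eqF.
Qed.

(** The inductive step of Brunn's theorem: [itg_BBL] is applied to [F] on the three fibres in
    direction [i] over [x], [y] and [mix th x y]. *)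
Lemma kconc_marg k S F i b : bmf F -> kconc k S F ->
  (forall x, S x -> - b <= tnth x i <= b) ->
  kconc k.+1 [set x | exists t, S (upd x i t)] (marg (- b) b i F).
Proof.
move=> bF [FS Fk Fc] Sb; have [mF F0 _] := bF.
split=> [x nS|x _|x y th [t St] [u Su] th01].
- rewrite /marg (@eq_itg _ _ _ _ (fun=> 0)); last first.
    by move=> t _; apply: FS => St; apply: nS; exists t.
  by rewrite /itg Rintegral_cst// mul0r.
- by rewrite rtK//; exact: itg_ge0.
split.
  exists ((1 - th) * t + th * u); rewrite -mix_upd.
  by have [] := Fc _ _ _ St Su th01.
pose fib z := [set t | S (upd z i t)].
have Sfib z u1 u2 tau : fib z u1 -> fib z u2 -> 0 < tau < 1 ->
    fib z ((1 - tau) * u1 + tau * u2) /\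
    (1 - tau) * rt k (F (upd z i u1)) + tau * rt k (F (upd z i u2)) <=
    rt k (F (upd z i ((1 - tau) * u1 + tau * u2))).
  move=> S1 S2 tau01; have [] := Fc _ _ _ S1 S2 tau01; rewrite mix_upd.
  rewrite (_ : mix tau z z = z)//; apply: eq_from_tnth => j.
  by rewrite tnth_mix -mulrDl subrK mul1r.
have F1 z : k = 0%N -> S z -> F z = 1 by move=> k0 /Fk ->; rewrite k0 expr0.
have ifib z : is_interval (fib z).
  by apply: convex_interval => u1 u2 tau S1 S2 /(Sfib _ _ _ _ S1 S2)[].
have fib_sub z : fib z `<=` `[- b, b].
  by move=> v /Sb; rewrite tnth_upd eqxx /= in_itv.
apply: (@itg_BBL _ k _ _ th (fib x) (fib y) (fib (mix th x y))) => //.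
- exact: bmf_upd.
- exact: bmf_upd.
- exact: bmf_upd.
- by exists t.
- by exists u.
- by move=> v; exact: FS.
- by move=> v; exact: FS.
- by move=> v; exact: FS.
- by move=> v; exact: Fk.
- by move=> v; exact: Fk.
- by move=> v; exact: Fk.
- move=> r; apply: convex_interval => u1 u2 tau [S1 r1] [S2 r2] tau01.
  have [S12 le12] := Sfib _ _ _ _ S1 S2 tau01; split=> //.
  (* For [k = 0] the function is 1 on [S], so a superlevel set in a fibre is empty or the whole
     fibre. *)
  have [k0|k0] := posnP k; first by move: r1; rewrite !F1.
  have [r0|r0] := leP r 0; first exact: le_trans (F0 _).
  rewrite -[r](@rtK _ k) ?(ltW r0)// Fk//.
  apply: lerXn2r; rewrite ?nnegrE ?rt_ge0//; apply: le_trans le12.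
  have /andP[tau0 tau1] := tau01.
  have tau1' : 0 <= 1 - tau by rewrite subr_ge0 ltW.
  rewrite [leLHS](_ : _ = (1 - tau) * rt k r + tau * rt k r); last first.
    by rewrite -mulrDl subrK mul1r.
  by rewrite lerD// ler_wpM2l ?(ltW tau0)// ler_rt// ltW.
- by move=> u1 u2 S1 S2; have := Fc _ _ _ S1 S2 th01; rewrite mix_upd.
Qed.

(** The projection of [S] along the coordinates in [s], kept as a cylinder. The nesting follows the
    recursion of [margs]; [shadowE] unfolds it. *)
Fixpoint shadow s S : set T :=
  if s is i :: s' then [set x | exists t, shadow s' S (upd x i t)] else S.

Lemma shadow_bound s S j b : j \notin s ->
  (forall x, S x -> - b <= tnth x j <= b) ->
  forall x, shadow s S x -> - b <= tnth x j <= b.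
Proof.
elim: s => //= i s IH; rewrite inE negb_or => /andP[ji js] Sb x [t /IH].
by rewrite tnth_upd (negbTE ji); apply.
Qed.

Lemma shadowE s S x : uniq s ->
  shadow s S x <-> exists2 y, S y & forall j, j \notin s -> tnth y j = tnth x j.
Proof.
elim: s x => [x _|i s IH x] /=.
  split=> [Sx|[y Sy yx]]; first by exists x.
  by rewrite (_ : x = y)//; apply: eq_from_tnth => j; rewrite yx.
move=> /andP[si us]; split.
  move=> [t /IH] /(_ us)[y Sy yx]; exists y => // j.
  by rewrite inE negb_or => /andP[ji js]; rewrite yx// tnth_upd (negbTE ji).
move=> [y Sy yx]; exists (tnth y i); apply/IH => //; exists y => // j js.
rewrite tnth_upd; case: eqVneq => [->//|ji].
by rewrite yx// inE negb_or ji.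
Qed.

(** For [k = 0] and [F] the indicator of a convex set this is Brunn's theorem on volumes of parallel
    sections. *)
Lemma kconc_margs k S F s b : bmf F -> kconc k S F -> uniq s ->
  (forall x j, j \in s -> S x -> - b <= tnth x j <= b) ->
  kconc (k + size s) (shadow s S) (margs b s F).
Proof.
move=> bF cF; elim: s => [|i s IH] /=; first by rewrite addn0.
move=> /andP[si us] Sb; rewrite addnS.
apply: kconc_marg; first exact: bmf_margs.
  by apply: IH => // x j js; apply: Sb; rewrite inE js orbT.
by apply: shadow_bound => // x; apply: Sb; rewrite mem_head.
Qed.

End brunn.

(** * Berwald's inequality *)

Section berwald_one_dimensional.
Context {R : realType}.

Lemma itg_restrict (a c1 c2 : R) (f : R -> R) :
  c1 <= c2 -> (forall t, c1 < t -> f t = 0) -> itg a c2 f = itg a c1 f.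
Proof.
move=> c12 f0; rewrite /itg Rintegral_mkcond [RHS]Rintegral_mkcond.
congr (Rintegral _ _ _); apply/funext => t; rewrite !patchE.
have [tc|tc] := leP t c1; last by rewrite f0//; case: ifP; case: ifP.
congr (if _ then _ else _); apply/idP/idP; rewrite !inE/= !in_itv/=.
  by move=> /andP[-> _]; rewrite tc.
by move=> /andP[-> _]; rewrite (le_trans tc).
Qed.

Lemma itg_power (p : nat) (a : R) : 0 <= a ->
  p.+1%:R * itg 0 a (fun t => t ^+ p) = a ^+ p.+1.
Proof.
rewrite le_eqVlt => /predU1P[<-|a0].
  by rewrite /itg set_itv1 Rintegral_set1 mulr0 expr0n.
rewrite /itg /Rintegral (@continuous_FTC2 _ _ (fun x => x ^+ p.+1 / p.+1%:R))//=.
- by rewrite expr0n/= mul0r subr0 mulrC divfK// pnatr_eq0.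
- by apply: continuous_in_subspaceT => x _; exact: exprn_continuous.
- split.
  + by move=> x _; apply: derivableM => //; exact: exprn_derivable.
  + apply: cvg_at_right_filter; apply: cvgM; last exact: cvg_cst.
    exact: exprn_continuous.
  + apply: cvg_at_left_filter; apply: cvgM; last exact: cvg_cst.
    exact: exprn_continuous.
- move=> x _; rewrite derive1Mr; last exact: exprn_derivable.
  by rewrite derive1E exp_derive scaler1 mulrAC divff ?mul1r.
Qed.

Lemma bmf_expM (M : R) (p : nat) (V : R -> R) : bmf V ->
  (forall r, V r != 0 -> 0 <= r <= M) -> bmf (fun r : R => r ^+ p * V r).
Proof.
move=> bV V0; have [mV pV _] := bV; have [N N0 VN] := bmf_bound bV.
split.
- by apply: measurable_funM => //; exact: measurable_funX.
- move=> r; have [->|/V0/andP[r0 _]] := eqVneq (V r) 0; first by rewrite mulr0.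
  by rewrite mulr_ge0 ?exprn_ge0.
- exists (`|M| ^+ p * N) => r.
  have [->|/V0/andP[r0 rM]] := eqVneq (V r) 0.
    by rewrite mulr0 mulr_ge0 ?exprn_ge0// ltW.
  apply: ler_pM => //; rewrite ?exprn_ge0// lerXn2r ?nnegrE//.
  exact: le_trans (ler_norm M).
Qed.

(** The origin of the binomials: with [k = a + 1], the integral of [k r^(k-1) (1-r)^d] over the unit
    interval is [1 / C(d+k, k)]. *)
Lemma binomial_beta (a d : nat) :
  'C(d + a.+1, a.+1)%:R * (a.+1%:R * beta_fun a.+1 d.+1) = 1 :> R.
Proof.
have /(congr1 (fun m => m%:R : R)) := bin_fact (leq_addl d a.+1).
rewrite addnK factS !natrM beta_fun_fact natrM.
rewrite (_ : (a + d).+1 = d + a.+1)%N; last by rewrite addnS addnC.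
move=> <-; set c := 'C(_, _)%:R.
have c0 : c != 0 by rewrite /c pnatr_eq0 -lt0n bin_gt0 leq_addl.
have f0 m : m`!%:R != 0 :> R by rewrite pnatr_eq0 -lt0n fact_gt0.
by field; rewrite ?nat1r ?natr1 ?f0 ?c0 ?pnatr_eq0.
Qed.

(* V^(1/d) is concave and agrees at 0 with the affine function U^(1/d), so V - U changes sign once,
   at rs, from + to -.  Hence (r^(s-k) - rs^(s-k)) (V r - U r) <= 0 for all r. *)
Lemma berwald_1d (d k s : nat) (V : R -> R) (D : set R) (r0 : R) :
  (0 < k)%N -> (k <= s)%N -> 1 <= r0 -> bmf V ->
  (forall r, ~ D r -> V r = 0) -> (forall r, D r -> V r = rt d (V r) ^+ d) ->
  (forall u v th, D u -> D v -> 0 < th < 1 -> D ((1 - th) * u + th * v) /\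
    (1 - th) * rt d (V u) + th * rt d (V v) <= rt d (V ((1 - th) * u + th * v))) ->
  D `<=` `[0, r0] -> D 0 ->
  'C(d + k, k)%:R * (k%:R * itg 0 r0 (fun r => r ^+ k.-1 * V r)) <= V 0 ->
  'C(d + s, s)%:R * (s%:R * itg 0 r0 (fun r => r ^+ s.-1 * V r)) <= V 0.
Proof.
case: k => // k _; case: s => // s; rewrite ltnS => ks r01 bV VD Vd Vc Dr0 D0 /=.
have [mV pV _] := bV.
pose q := V 0; rewrite -/q => Hk.
have q0 : 0 <= q by exact: pV.
(* The extremal profile, that of a cone: its normalised moments are all equal to [q = V 0]. *)
pose U r := q * ((1 - r) ^+ d * \1_(`[0, 1]) r) : R.
have UE r : 0 <= r <= 1 -> U r = q * (1 - r) ^+ d.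
  by move=> r1; rewrite /U indicE mem_set ?mulr1//= in_itv.
have U0 r : ~~ (0 <= r <= 1) -> U r = 0.
  move=> r1; rewrite /U indicE (_ : (r \in _) = false) ?mulr0//.
  by apply/negbTE; rewrite notin_setE/= in_itv/=; apply/negP.
have pU r : 0 <= U r.
  case: (boolP (0 <= r <= 1)) => r1; last by rewrite U0.
  by rewrite UE// mulr_ge0// exprn_ge0// subr_ge0; case/andP: r1.
have bU : bmf U.
  split=> //.
    apply: measurable_funM => //; apply: measurable_funM.
      by apply: measurable_funX; exact: measurable_funB.
    exact: measurable_indic.
  exists q => r; case: (boolP (0 <= r <= 1)) => r1; last by rewrite U0.
  have /andP[r_0 r_1] := r1.
  by rewrite UE// ler_piMr// exprn_ile1 ?subr_ge0// lerBlDr lerDl.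
have Ubeta p : itg 0 r0 (fun r => r ^+ p * U r) = q * beta_fun p.+1 d.+1.
  rewrite (@itg_restrict _ 1)//; last first.
    by move=> t t1; rewrite U0 ?mulr0// negb_and -!ltNge t1 orbT.
  rewrite /beta_fun -Rintegral_mkcond -RintegralZl//; last exact: integrable_XMonemX.
  by apply: eq_itg => t t01; rewrite UE// mulrCA.
(* By concavity and equality at 0, every point between 0 and a point of [A] is in [A]; the sign
   change is therefore at the supremum. *)
pose A := [set r | D r /\ rt d q * (1 - r) <= rt d (V r)].
have A0 : A 0 by split=> //; rewrite subr0 mulr1.
have sA : has_sup A.
  split; first by exists 0.
  by exists r0 => r [/Dr0/=]; rewrite in_itv/= => /andP[].
pose rs := sup A.
have rs0 : 0 <= rs by apply: (sup_ubound sA.2).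
have below r : 0 < r -> r < rs -> U r <= V r.
  move=> r_gt0 /(sup_gt sA.1)[r' [Dr' Vr'] rr'].
  have r'0 : 0 < r' by exact: lt_trans rr'.
  have th01 : 0 < r / r' < 1 by rewrite divr_gt0//= ltr_pdivrMr// mul1r.
  have [] := Vc _ _ _ D0 Dr' th01; rewrite mulr0 add0r divfK ?gt_eqF// => Dr le.
  case: (boolP (0 <= r <= 1)) => r1; last by rewrite U0.
  rewrite UE// [leRHS]Vd// {1}/q (Vd _ D0) -/q -exprMn.
  have /andP[_ r_1] := r1.
  apply: lerXn2r; rewrite ?nnegrE ?mulr_ge0 ?rt_ge0 ?subr_ge0//.
  apply: le_trans le; have /andP[th0 th1] := th01.
  apply: (@le_trans _ _ ((1 - r / r') * rt d q + r / r' * (rt d q * (1 - r')))).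
    rewrite le_eqVlt; apply/orP; left; apply/eqP; field.
    by rewrite gt_eqF.
  by rewrite lerD2l ler_wpM2l// ltW.
have above r : 0 < r -> rs < r -> V r <= U r.
  move=> r_gt0 rsr; have [Dr|/VD -> //] := pselect (D r).
  have : ~ A r by move=> Ar; have := sup_ubound sA.2 Ar; rewrite leNgt rsr.
  move=> nA; have lt : rt d (V r) < rt d q * (1 - r).
    by rewrite ltNge; apply/negP => le; apply: nA.
  (* Beyond 1 the affine function is nonpositive and cannot strictly exceed a root. *)
  have r1 : r <= 1.
    rewrite leNgt; apply/negP => r1; move: lt; rewrite ltNge => /negP; apply.
    by apply: (@le_trans _ _ 0); rewrite ?rt_ge0// mulr_ge0_le0 ?rt_ge0// subr_le0 ltW.
  rewrite UE ?(ltW r_gt0)// [leLHS]Vd// {1}/q (Vd _ D0) -/q -exprMn.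
  by apply: lerXn2r; rewrite ?nnegrE ?mulr_ge0 ?rt_ge0 ?subr_ge0// ltW.
have V_supp r : V r != 0 -> 0 <= r <= r0.
  move=> Vr; have [/Dr0/=|/VD Vr0] := pselect (D r); first by rewrite in_itv.
  by rewrite Vr0 eqxx in Vr.
have U_supp r : U r != 0 -> 0 <= r <= r0.
  move=> Ur; case: (boolP (0 <= r <= 1)) => r1; last by rewrite U0 ?eqxx in Ur.
  by have /andP[-> rle] := r1; rewrite (le_trans rle).
have bV' p : bmf (fun r : R => r ^+ p * V r) by exact: (bmf_expM _ bV V_supp).
have bU' p : bmf (fun r : R => r ^+ p * U r) by exact: (bmf_expM _ bU U_supp).
pose e := rs ^+ (s - k).
have e0 : 0 <= e by exact: exprn_ge0.
(* The product inequality is rearranged so that all terms are nonnegative, as [bmf] demands. *)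
have ineq : itg 0 r0 (fun r => r ^+ s * V r + e * (r ^+ k * U r)) <=
    itg 0 r0 (fun r => r ^+ s * U r + e * (r ^+ k * V r)).
  apply: le_itg => [||r /andP[r_gt0 _]].
  - by apply: bmfD => //; apply: bmfM => //; exact: bmf_cst.
  - by apply: bmfD => //; apply: bmfM => //; exact: bmf_cst.
  rewrite -subr_ge0 -(subnKC ks) exprD.
  rewrite (_ : _ - _ = r ^+ k * ((r ^+ (s - k) - e) * (U r - V r))); last by ring.
  apply: mulr_ge0; first by rewrite exprn_ge0// ltW.
  have [rrs|rrs|->] := ltgtP r rs; last by rewrite /e subrr mul0r.
  - apply: mulr_le0; last by rewrite subr_le0 below.
    by rewrite subr_le0 lerXn2r ?nnegrE// ltW.
  - apply: mulr_ge0; last by rewrite subr_ge0 above.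
    by rewrite subr_ge0 lerXn2r ?nnegrE// ltW.
have bc : bmf (fun _ : R => e) by exact: bmf_cst.
move: ineq; rewrite !itgD//; try exact: bmfM.
rewrite !itgZ// !Ubeta.
have Bp p : 0 < 'C(d + p.+1, p.+1)%:R * p.+1%:R :> R.
  by rewrite -natrM ltr0n muln_gt0 bin_gt0 leq_addl.
have bk : itg 0 r0 (fun r => r ^+ k * V r) <= q * beta_fun k.+1 d.+1.
  rewrite -(ler_pM2l (Bp k)) -mulrA (le_trans Hk)// mulrCA -mulrA.
  by rewrite binomial_beta mulr1.
move=> ineq.
rewrite mulrA [leRHS](_ : _ =
    'C(d + s.+1, s.+1)%:R * s.+1%:R * (q * beta_fun s.+1 d.+1)).
  rewrite ler_pM2l// -(lerD2r (e * (q * beta_fun k.+1 d.+1))).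
  by apply: (le_trans ineq); rewrite lerD2l ler_wpM2l.
by rewrite mulrCA -mulrA binomial_beta mulr1.
Qed.

End berwald_one_dimensional.

(** * Berwald's inequality for iterated marginals *)

Section berwald.
Context {R : realType} {n : nat}.
Local Notation T := (n.-tuple (measurableTypeR R)).
Implicit Types (x y : T) (i j : 'I_n) (s : seq 'I_n) (S : set T) (F G : T -> R).

Lemma eq_margs b s F G x :
  (forall y, (forall j, j \notin s -> tnth y j = tnth x j) -> F y = G y) ->
  margs b s F x = margs b s G x.
Proof.
elim: s x => [x FG|i s IH x FG]; first exact: FG.
apply: eq_itg => t _; apply: IH => y yx; apply: FG => j.
by rewrite inE negb_or => /andP[ji js]; rewrite yx// tnth_upd (negbTE ji).
Qed.

Lemma margsZ b s F x (k : R) : bmf F ->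
  margs b s (fun y => k * F y) x = k * margs b s F x.
Proof.
move=> bF; elim: s x => //= i s IH x; rewrite /marg.
under eq_itg do rewrite IH.
by rewrite itgZ//; apply: bmf_upd; exact: bmf_margs.
Qed.

Lemma layer_power (p : nat) (c r0 a : R) : 0 < c -> 0 <= a -> a <= c * r0 ->
  c ^+ p.+1 * (p.+1%:R *
    itg 0 r0 (fun r => r ^+ p * \1_([set r : R | 0 <= r /\ r * c <= a]) r)) = a ^+ p.+1.
Proof.
move=> c0 a0 ar; have ac : a / c <= r0 by rewrite ler_pdivrMr// mulrC.
have a'0 : 0 <= a / c by rewrite divr_ge0// ltW.
rewrite (@itg_restrict _ _ (a / c))//; last first.
  move=> t ct; rewrite indicE; case: (boolP (t \in _)); last by rewrite mulr0.
  by rewrite inE/= => -[_]; rewrite -ler_pdivlMr// leNgt ct.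
rewrite (@eq_itg _ _ _ _ (fun t => t ^+ p)).
  by rewrite itg_power// -exprMn mulrC divfK// gt_eqF.
move=> t /andP[t0 ta]; rewrite indicE mem_set ?mulr1//; split=> //.
by rewrite -ler_pdivlMr.
Qed.

(* The level r of rt k F is measured in units of c and recorded in the coordinate j0, which
   neither S nor F depends on: the superlevel sets of F thus become the sections of one convex set D. *)
Lemma berwald_margs (k m : nat) b s j0 S F x :
  (0 < k)%N -> (k <= m)%N -> measurable S -> bmf F -> kconc k S F -> uniq s ->
  j0 \notin s -> indep F j0 -> (forall y t, S (upd y j0 t) <-> S y) ->
  (forall y j, j \in s -> S y -> - b <= tnth y j <= b) ->
  0 < margs b s \1_S x ->
  'C(size s + m, m)%:R *
    (margs b s (fun y => rt k (F y) ^+ m) x / margs b s \1_S x) <=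
  rt k ('C(size s + k, k)%:R * (margs b s F x / margs b s \1_S x)) ^+ m.
Proof.
move=> k0 km mS bF cF us j0s Fj0 Sj0 Sb q0.
have [FS Fk Fc] := cF; have [mF F0 _] := bF; have [M M0 FM] := bmf_bound bF.
set q := margs b s \1_S x in q0 *; set w := margs b s F x.
have w0 : 0 <= w by exact: margs_ge0.
have m0 : (0 < m)%N by exact: leq_trans km.
pose phi y := rt k (F y).
have bphi : bmf phi by apply: bmf_powR => //; rewrite invr_ge0.
have phiM y : phi y <= rt k M by exact: ler_rt.
have phi0 y : 0 <= phi y by exact: rt_ge0.
have phik y : phi y ^+ k = F y by rewrite rtK.
have phiS y : ~ S y -> phi y = 0.
  by move=> /FS Fy; rewrite /phi /rt Fy powR0// invr_eq0 pnatr_eq0 -lt0n.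
have C0 p : 0 < 'C(size s + p, p)%:R :> R by rewrite ltr0n bin_gt0 leq_addl.
(* The unit [c] below would vanish here; but then so does the left side, because [phi ^+ m] is at
   most a constant times [F]. *)
have [w_0|w_neq0] := eqVneq w 0.
  rewrite (_ : margs b s _ x = 0) ?mul0r ?mulr0 ?exprn_ge0 ?rt_ge0//.
  apply/le_anti/andP; split; last by apply: margs_ge0 => y; rewrite exprn_ge0 ?rt_ge0.
  rewrite -(mulr0 (rt k M ^+ (m - k))) -w_0 -margsZ//.
  apply: le_margs => [||y].
  - exact: bmf_exp.
  - by apply: bmfM => //; apply: bmf_cst; rewrite exprn_ge0 ?rt_ge0.
  - rewrite -/(phi y) -[in leLHS](subnK km) exprD phik ler_wpM2r//.
    by apply: lerXn2r; rewrite ?nnegrE ?rt_ge0.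
have w_gt0 : 0 < w by rewrite lt_neqAle eq_sym w_neq0.
(* With this unit the moment hypothesis of [berwald_1d] for exponent [k] holds with equality. *)
set c := rt k _.
have c0 : 0 < c. by rewrite powR_gt0// mulr_gt0// divr_gt0.
have ck : c ^+ k = 'C(size s + k, k)%:R * (w / q).
  by rewrite rtK// mulr_ge0// divr_ge0// ltW.
(* At least 1 to contain the support of the cone profile, and large enough that [c * r0] bounds
   [phi]. *)
pose r0 := Num.max 1 (rt k M / c).
have r01 : 1 <= r0 by rewrite le_max lexx.
have r0_ge0 : 0 <= r0 by exact: le_trans r01.
have phir0 y : phi y <= c * r0.
  rewrite mulrC -ler_pdivrMr// le_max; apply/orP; right.
  by rewrite ler_pM2r ?invr_gt0.
pose D := [set y | S y /\ 0 <= tnth y j0 /\ tnth y j0 * c <= phi y].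
have mD : measurable D.
  apply: measurableI => //; apply: measurableI.
    rewrite -[X in measurable X]setTI; apply: measurable_fun_le => //.
    exact: measurable_tnth.
  rewrite -[X in measurable X]setTI; apply: measurable_fun_le => //.
    by apply: measurable_funM => //; exact: measurable_tnth.
  by case: bphi.
have bD : bmf (\1_D : T -> R) by exact: bmf_indic.
have cD : kconc 0 D (\1_D : T -> R).
  apply: kconc_indic => y z th [Sy [y0 yphi]] [Sz [z0 zphi]] th01.
  have [Syz le] := Fc _ _ _ Sy Sz th01; have /andP[th0 th1] := th01.
  have t1 : 0 <= 1 - th by rewrite subr_ge0 ltW.
  split=> //; rewrite tnth_mix; split; first by rewrite addr_ge0// mulr_ge0// ltW.
  by apply: le_trans le; rewrite mulrDl -!mulrA lerD// ler_wpM2l// ltW.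
(* Brunn's theorem for [D]: the volume of the superlevel set at level [r * c] has a concave root of
   order [size s] in [r]. *)
have cV := kconc_margs (b := b) bD cD us (fun y j js yD => Sb y j js yD.1).
rewrite add0n in cV; have {cV}[VD Vd Vc] := cV.
pose V r := margs b s \1_D (upd x j0 r).
have bV : bmf V by apply: bmf_upd; exact: bmf_margs.
have V0 : V 0 = q.
  transitivity (margs b s \1_S (upd x j0 0)).
    apply: eq_margs => y yx; rewrite !indicE; congr ((nat_of_bool _)%:R).
    have y0 : tnth y j0 = 0 by rewrite yx// tnth_upd eqxx.
    apply/idP/idP; rewrite !inE; first by case.
    by move=> Sy; split=> //; rewrite y0 mul0r.
  have S_indep : indep (\1_S : T -> R) j0.
    move=> y t; rewrite !indicE; congr ((nat_of_bool _)%:R).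
    by apply/idP/idP; rewrite !inE => /Sj0.
  by rewrite /q (indep_margs b s S_indep).
have layer p (P : nat) : p.+1 = P ->
    margs b s (fun y => phi y ^+ P) x =
    c ^+ P * (P%:R * itg 0 r0 (fun r => r ^+ P.-1 * V r)).
  move=> <- /=.
  pose G y := tnth y j0 ^+ p * \1_D y.
  have bG : bmf G.
    split.
    - by apply: measurable_funM; [apply: measurable_funX; exact: measurable_tnth|
        exact: measurable_indic].
    - move=> y; rewrite /G indicE; case: (boolP (y \in D)); last by rewrite mulr0.
      by rewrite inE => -[_ [y0 _]]; rewrite mulr1 exprn_ge0.
    - exists (r0 ^+ p) => y; rewrite /G indicE; case: (boolP (y \in D)); last first.
        by rewrite mulr0 exprn_ge0.
      rewrite inE => -[_ [y0 yphi]]; rewrite mulr1 lerXn2r ?nnegrE//.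
      by rewrite -(ler_pM2r c0) (le_trans yphi)// mulrC.
  transitivity (margs b s (fun y => (c ^+ p.+1 * p.+1%:R) * marg 0 r0 j0 G y) x).
    apply: eq_margs => y _; rewrite /marg /G.
    have [Sy|nSy] := pselect (S y).
      rewrite -(layer_power p c0 (phi0 y) (phir0 y)) mulrA; congr (_ * _).
      apply: eq_itg => r _; rewrite tnth_upd eqxx !indicE.
      have DE : D (upd y j0 r) <-> 0 <= r /\ r * c <= phi y.
        rewrite /D/= tnth_upd eqxx /phi Fj0; split=> [[]//|rphi].
        by split=> //; exact/Sj0.
      by congr (_ * (nat_of_bool _)%:R); apply/idP/idP; rewrite !inE => /DE.
    rewrite phiS// expr0n/= (@eq_itg _ _ _ _ (fun=> 0)).
      by rewrite /itg Rintegral_cst// mul0r mulr0.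
    move=> r _; rewrite indicE; case: (boolP (_ \in D)); last by rewrite mulr0.
    by rewrite inE => -[/Sj0].
  rewrite margsZ; last exact: bmf_marg.
  rewrite -marg_margsC// -mulrA; congr (_ * (_ * _)); apply: eq_itg => r _.
  rewrite -margsZ//; apply: eq_margs => y yx; rewrite /G yx//.
  by rewrite tnth_upd eqxx.
have D'0 : shadow s D (upd x j0 0).
  have [//|/VD] := pselect (shadow s D (upd x j0 0)); rewrite -/(V 0) V0 => q_0.
  by move: q0; rewrite q_0 ltxx.
have H : 'C(size s + m, m)%:R * (m%:R * itg 0 r0 (fun r => r ^+ m.-1 * V r)) <= q.
  rewrite -V0.
  apply: (@berwald_1d _ _ k _ V [set r | shadow s D (upd x j0 r)] _ k0 km r01 bV).
  - by move=> r; exact: VD.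
  - by move=> r; exact: Vd.
  - move=> u v th Du Dv th01; have := Vc _ _ _ Du Dv th01.
    rewrite mix_upd (_ : mix th x x = x)//; apply: eq_from_tnth => j.
    by rewrite tnth_mix -mulrDl subrK mul1r.
  - move=> r /(shadowE _ _ us)[y [_ [y0 yphi]] yx] /=.
    have yr : tnth y j0 = r by rewrite yx// tnth_upd eqxx.
    rewrite in_itv/= -yr y0/= -(ler_pM2r c0) (le_trans yphi)//.
    by rewrite mulrC.
  - exact: D'0.
  - have := layer k.-1 k (prednK k0).
    rewrite (_ : margs b s _ x = w); last by apply: eq_margs => y _; exact: phik.
    move=> wE; rewrite V0 -(ler_pM2l (exprn_gt0 k c0)) mulrCA -wE ck.
    by rewrite -mulrA divfK// gt_eqF.
rewrite (layer m.-1 m (prednK m0)) mulrA ler_pdivrMr// mulrCA.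
by rewrite ler_pM2l// exprn_gt0.
Qed.

End berwald.

(** * Uniform covers *)

Section uniform_cover_inequality.
Context {R : realType} {n : nat}.
Local Notation T := (n.-tuple (measurableTypeR R)).

Lemma cyl_mix (tau : {set 'I_n}) (K : set 'rV[R]_n) x y th :
  @convex_set R 'rV[R]_n K -> cyl tau K x -> cyl tau K y -> 0 < th < 1 ->
  cyl tau K (mix th x y).
Proof.
move=> cK [z Kz zx] [u Ku uy] /andP[th0 th1].
have := cK u z (Itv01 (ltW th0) (ltW th1)); rewrite !inE => /(_ Ku Kz) Kc.
exists (th *: u + (1 - th) *: z) => // i it.
by rewrite !mxE tnth_mix zx// uy// addrC.
Qed.

Lemma shadow_cyl (tau sigma : {set 'I_n}) (K : set 'rV[R]_n) : tau \subset sigma ->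
  shadow [seq j <- enum sigma | j \notin tau] (cyl tau K) = cyl sigma K.
Proof.
move=> /fintype.subsetP ts; rewrite predeqE => x; rewrite shadowE; last first.
  by rewrite filter_uniq// enum_uniq.
split=> [[y [z Kz zy] yx]|[z Kz zx]].
  exists z => // i is_; rewrite zy; last by apply: contra is_; exact: ts.
  by rewrite yx// mem_filter mem_enum (negbTE is_) andbF.
exists [tuple if (i \notin tau) && (i \in sigma) then z 0 i else tnth x i | i < n].
  exists z => // i it; rewrite tnth_mktuple it; case: ifPn => //.
  exact: zx.
by move=> j; rewrite mem_filter mem_enum tnth_mktuple => /negbTE ->.
Qed.

Lemma cyl_upd (tau : {set 'I_n}) (K : set 'rV[R]_n) j x t :
  j \in tau -> cyl tau K (upd x j t) <-> cyl tau K x.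
Proof.
have sub y u : j \in tau -> cyl tau K y -> cyl tau K (upd y j u).
  move=> jt [z Kz zy]; exists z => // i it; rewrite tnth_upd.
  by case: eqVneq it => [->|_ /zy//]; rewrite jt.
move=> jt; split; last exact: sub.
by move=> /(sub _ (tnth x j) jt); rewrite upd_upd upd_id.
Qed.

Lemma indep_cyl (tau : {set 'I_n}) (K : set 'rV[R]_n) j :
  j \in tau -> indep (\1_(cyl tau K) : T -> R) j.
Proof.
move=> jt x t; rewrite !indicE; congr ((nat_of_bool _)%:R).
by apply/idP/idP; rewrite !inE => /cyl_upd; exact.
Qed.

Lemma size_filter_setC (tau sigma : {set 'I_n}) : tau \subset sigma ->
  (size [seq j <- enum sigma | j \notin tau] + #|tau| = #|sigma|)%N.
Proof.
move=> ts; rewrite size_filter addnC [RHS]cardE -(count_predC (mem tau)).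
congr (_ + _)%N; rewrite -size_filter cardE; apply/esym/perm_size/uniq_perm.
- by rewrite filter_uniq// enum_uniq.
- exact: enum_uniq.
- move=> j; rewrite mem_filter !mem_enum andb_idr//.
  exact/fintype.subsetP.
Qed.

Lemma perm_enum_setC (tau sigma : {set 'I_n}) : tau \subset sigma ->
  perm_eq (enum (~: tau))
    (enum (~: sigma) ++ [seq j <- enum sigma | j \notin tau]).
Proof.
move=> /fintype.subsetP ts; apply: uniq_perm; first exact: enum_uniq.
  rewrite cat_uniq enum_uniq filter_uniq ?enum_uniq ?andbT//=; apply/hasPn => j.
  by rewrite mem_filter !mem_enum !inE => /andP[_ ->].
move=> j; rewrite mem_cat !mem_enum mem_filter mem_enum !inE.
by have := ts j; case: (j \in tau) => [/(_ isT) ->|_]//; case: (j \in sigma).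
Qed.

(** The nondegenerate case, in which [m - lambda], the cardinality of [sigma] and the volume of the
    projection can be divided by. *)
Lemma volume_cyl_le (lambda m : nat) (sigma : {set 'I_n})
    (sigmas : 'I_m -> {set 'I_n}) (K : set 'rV[R]_n) (b : R) (x : T) :
  (0 < lambda)%N -> (lambda < m)%N -> (0 < #|sigma|)%N ->
  uniform_cover lambda sigma sigmas ->
  compact K -> @convex_set R 'rV[R]_n K ->
  (forall z j, K z -> - b <= z 0 j <= b) ->
  0 < margs b (enum (~: sigma)) \1_(cyl sigma K) x ->
  margs b (enum 'I_n) \1_(cyl finset.set0 K) x ^+ (m - lambda) *
    margs b (enum (~: sigma)) \1_(cyl sigma K) x ^+ lambda <=
  (\prod_(i < m) 'C(n - #|sigmas i|, n - #|sigma|)%:R) /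
    'C(n, n - #|sigma|)%:R ^+ (m - lambda) *
  \prod_(i < m) margs b (enum (~: (sigmas i))) \1_(cyl (sigmas i) K) x.
Proof.
move=> lam0 lamm sig0 [sub cov] cK convK Kb q0.
set q := margs b (enum (~: sigma)) _ x in q0 *.
pose s := #|sigma|; pose p := (m - lambda)%N.
have p0 : (0 < p)%N by rewrite subn_gt0.
pose S := cyl sigma K; pose G i := cyl (sigmas i) K.
pose si i := [seq j <- enum sigma | j \notin sigmas i].
pose k i := size (si i).
pose d := size (enum (~: sigma)).
have ds : (d + s = n)%N by rewrite /d -cardE addnC cardsC card_ord.
pose g i : T -> R := margs b (si i) \1_(G i).
have mcyl tau : measurable (cyl tau K) by exact: compact_cyl_measurable.
have bcyl tau : bmf (\1_(cyl tau K) : T -> R) by exact: bmf_indic.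
have bg i : bmf (g i) by apply: bmf_margs; exact: bcyl.
have g0 i y : 0 <= g i y by case: (bg i).
have cg i : kconc (k i) S (g i).
  rewrite /S -(shadow_cyl K (sub i)) -[k i]add0n; apply: kconc_margs.
  - exact: bcyl.
  - apply: kconc_indic => y z th Sy Sz th01; exact: (cyl_mix convK Sy Sz th01).
  - by apply: filter_uniq; exact: enum_uniq.
  - move=> y j; rewrite mem_filter => /andP[jt _] [z Kz zy].
    by rewrite -zy//; exact: Kb.
have card_notin j : j \in sigma -> (\sum_(i < m | j \notin sigmas i) 1 = p)%N.
  move=> js; rewrite /p -[in RHS](card_ord m) -(cov _ js).
  rewrite -(cardC [pred i | j \in sigmas i]) [X in (_ - X)%N](_ : _ = #|[pred i | j \in sigmas i]|).
    by rewrite addKn sum1_card; apply: eq_card => i; rewrite !inE.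
  by apply: eq_card => i; apply/idP/idP; rewrite !inE.
have sum_k : (\sum_i k i = p * s)%N.
  under eq_bigr do rewrite /k size_filter -sum1_count.
  rewrite (exchange_big_dep xpredT)//=.
  rewrite (eq_big_seq (fun=> p)) => [|j]; last by rewrite mem_enum; exact: card_notin.
  by rewrite big_const_seq count_predT iter_addn_0 -cardE.
have s0 : s%:R != 0 :> R by rewrite pnatr_eq0 -lt0n.
have p_neq0 : p%:R != 0 :> R by rewrite pnatr_eq0 -lt0n.
(* The indicator matters for [k i = 0], where the root is 1 outside [S] as well. *)
pose H i y := \1_S y * rt (k i) (g i y) ^+ s.
have bH i : bmf (H i).
  apply: bmfM; first exact: bcyl.
  by apply: bmf_exp; apply: bmf_powR; rewrite ?invr_ge0.
have H0 i y : 0 <= H i y by case: (bH i).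
pose N i := margs b (enum (~: sigma)) (H i) x.
pose w i := margs b (enum (~: (sigmas i))) \1_(G i) x.
pose e i : R := (k i)%:R / (p%:R * s%:R).
have e0 i : 0 <= e i by rewrite /e divr_ge0 ?mulr_ge0 ?ler0n.
have sum_e : \sum_i e i = 1.
  by rewrite -mulr_suml -natr_sum sum_k natrM divff// mulf_neq0.
have wE i : w i = margs b (enum (~: sigma)) (g i) x.
  by rewrite /w (perm_margs _ (bcyl _) (perm_enum_setC (sub i))) margs_cat.
have N0 i : 0 <= N i by exact: margs_ge0.
have fib y : margs b (enum sigma) \1_(cyl finset.set0 K) y <= \prod_i H i y `^ e i.
  have [Sy|nSy] := pselect (S y); last first.
    rewrite margs_eq0; first by apply: prodr_ge0 => i _; exact: powR_ge0.
    move=> y' y'y; rewrite indicE; case: (boolP (y' \in _)) => //; rewrite inE => -[z Kz zy'].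
    exfalso; apply: nSy; exists z => // j js; rewrite zy' ?inE//.
    by apply: y'y; rewrite mem_enum.
  (* On [S], [g i] is the [k i]-th power of its root, and [s * e i = k i / p]. *)
  have -> : \prod_i H i y `^ e i = \prod_i g i y `^ p%:R^-1.
    apply: eq_bigr => i _; have [_ gk _] := cg i.
    rewrite [in RHS](gk _ Sy) /H indicE mem_set// mul1r.
    rewrite -!(powR_mulrn _ (rt_ge0 (k i) (g i y))) -!powRrM; congr (_ `^ _).
    have aux (a u v : R) : u != 0 -> v != 0 -> v * (a / (u * v)) = a * u^-1.
      by move=> u0 v0; field; rewrite u0.
    by rewrite aux.
  (* [K] lies in every cylinder [G i]. The weights [1/p] suit [margs_prod_holder] because each [j]
     in [sigma] is missed by exactly [p] of the [sigmas i]. *)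
  apply: (@le_trans _ _ (margs b (enum sigma)
      (fun y => \prod_i (\1_(G i) y) `^ p%:R^-1) y)).
    apply: le_margs => [||y'].
    - exact: bcyl.
    - apply: bmf_prod => i; apply: bmf_powR; last exact: bcyl.
      by rewrite invr_ge0.
    - rewrite indicE; case: (boolP (y' \in _)) => [|_]; last first.
        by apply: prodr_ge0 => i _; exact: powR_ge0.
      rewrite inE => -[z Kz zy']; rewrite big1// => i _.
      rewrite indicE mem_set ?powR1//; exists z => // j _; apply: zy'.
      by rewrite inE.
  apply: margs_prod_holder => [i|i|i j|j].
  - by rewrite invr_ge0.
  - exact: bcyl.
  - exact: indep_cyl.
  - rewrite mem_enum => js; rewrite sumr_const -sum1_card card_notin//.
    by rewrite -[_ *+ _]mulr_natr mulVf.
have vN : margs b (enum 'I_n) \1_(cyl finset.set0 K) x <= \prod_i N i `^ e i.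
  have pe : perm_eq (enum 'I_n) (enum (~: sigma) ++ enum sigma).
    apply: uniq_perm; rewrite ?enum_uniq//.
      rewrite cat_uniq !enum_uniq andbT/=; apply/hasPn => j.
      by rewrite /= !mem_enum !inE negbK.
    by move=> j; rewrite mem_cat !mem_enum !inE; case: (j \in sigma).
  rewrite (perm_margs _ (bcyl _) pe) margs_cat.
  apply: (@le_trans _ _ (margs b (enum (~: sigma)) (fun y => \prod_i H i y `^ e i) x)).
    apply: le_margs => //; first by apply: bmf_margs; exact: bcyl.
    by apply: bmf_prod => i; exact: bmf_powR.
  rewrite (_ : \prod_i N i `^ e i = \prod_i
     margs b [seq j <- enum (~: sigma) | j \notin finset.set0] (H i) x `^ e i).
    apply: margs_prod_holder => // [i j|j _]; first by rewrite inE.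
    by rewrite -[RHS]sum_e; apply: eq_bigl => i; rewrite inE.
  apply: eq_bigr => i _; rewrite (_ : [seq _ <- _ | _] = enum (~: sigma))//.
  by apply/all_filterP/allP => j _; rewrite inE.
have NB i : ('C(d + s, s)%:R * (N i / q)) `^ ((k i)%:R / s%:R) <=
    'C(d + k i, k i)%:R * (w i / q).
  have [k0|k0] := posnP (k i).
    rewrite k0 mul0r powRr0 addn0 bin0 mul1r wE (_ : margs _ _ _ _ = q) ?divff ?gt_eqF//.
    congr margs; apply/funext => y; have [gS gk _] := cg i.
    have [Sy|nSy] := pselect (S y); first by rewrite gk// k0 expr0 indicE mem_set.
    by rewrite gS// indicE memNset.
  (* Any element of [sigma] can carry the level: [g i] does not depend on it, as it is either free
     in the cylinder or integrated out. *)
  have [j0 js] : exists j0, j0 \in sigma by apply/card_gt0P.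
  have ks : (k i <= s)%N by rewrite /s -(size_filter_setC (sub i)) leq_addr.
  have gj0 : indep (g i) j0.
    have [ji|ji] := boolP (j0 \in sigmas i).
      by apply: indep_margs; exact: indep_cyl.
    by apply: indep_margs_in; rewrite mem_filter ji mem_enum.
  have Sj0 y t : S (upd y j0 t) <-> S y by exact: cyl_upd.
  have Sb y j : j \in enum (~: sigma) -> S y -> - b <= tnth y j <= b.
    by rewrite mem_enum inE => jns [z Kz zy]; rewrite -zy//; exact: Kb.
  have j0' : j0 \notin enum (~: sigma) by rewrite mem_enum inE js.
  have := berwald_margs k0 ks (mcyl sigma) (bg i) (cg i) (enum_uniq _) j0' gj0 Sj0 Sb q0.
  rewrite -wE -/q -/d (_ : margs _ _ _ _ = N i); last first.
    apply: eq_margs => y _; rewrite /H.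
    have [Sy|nSy] := pselect (S y); first by rewrite indicE mem_set// mul1r.
    have [gS _ _] := cg i.
    rewrite gS// /rt powR0 ?invr_eq0 ?pnatr_eq0 -?lt0n//.
    by rewrite expr0n gtn_eqF// mulr0.
  set B := 'C(d + k i, k i)%:R * _ => le.
  have B0 : 0 <= B.
    rewrite mulr_ge0 ?ler0n// divr_ge0 ?(ltW q0)//.
    by apply: margs_ge0 => y; case: (bcyl (sigmas i)).
  have ks0 : 0 <= (k i)%:R / s%:R :> R by rewrite divr_ge0 ?ler0n.
  have lhs0 : 0 <= 'C(d + s, s)%:R * (N i / q).
    by rewrite mulr_ge0 ?ler0n// divr_ge0 ?(ltW q0)// N0.
  apply: (le_trans (ge0_ler_powR ks0 lhs0 (exprn_ge0 s (rt_ge0 _ _)) le)).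
  have aux (a u : R) : a != 0 -> u != 0 -> a^-1 * (u * (a / u)) = 1.
    by move=> a0 u0; field; rewrite ?a0 ?u0.
  rewrite -(powR_mulrn s (rt_ge0 _ _)) /rt -!powRrM aux ?powRr1//.
  by rewrite pnatr_eq0 -lt0n.
pose v := margs b (enum 'I_n) \1_(cyl finset.set0 K) x; rewrite -/v in vN *.
have v0 : 0 <= v by apply: margs_ge0 => y; case: (bcyl finset.set0).
pose C : R := 'C(d + s, s)%:R.
have C0 : 0 < C by rewrite ltr0n bin_gt0 leq_addl.
(* The product of the bounds [NB i]: the exponents [k i / s] add up to [p], which collects the
   factors [C / q] into a p-th power. *)
have main : (C / q * v) ^+ p <= \prod_i ('C(d + k i, k i)%:R * (w i / q)).
  apply: (@le_trans _ _ (\prod_i (C * (N i / q)) `^ ((k i)%:R / s%:R))).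
    rewrite (_ : \prod_i _ = (C / q * \prod_i N i `^ e i) ^+ p).
      apply: lerXn2r; rewrite ?nnegrE ?mulr_ge0 ?invr_ge0 ?(ltW C0) ?(ltW q0)//.
        by apply: prodr_ge0 => i _; exact: powR_ge0.
      by rewrite ler_wpM2l// divr_ge0 ?(ltW C0) ?(ltW q0).
    rewrite exprMn -prodrXl.
    rewrite -(powR_mulrn p (_ : 0 <= C / q)) ?divr_ge0 ?(ltW C0) ?(ltW q0)//.
    rewrite (_ : p%:R = \sum_i (k i)%:R / s%:R :> R); last first.
      by rewrite -mulr_suml -natr_sum sum_k natrM mulfK.
    rewrite powR_sum ?divr_gt0// -big_split/=; apply: eq_bigr => i _.
    rewrite -powR_mulrn ?powR_ge0// -powRrM.
    rewrite (_ : e i * p%:R = (k i)%:R / s%:R); last first.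
      have aux (a u z : R) : u != 0 -> z != 0 -> a / (u * z) * u = a / z.
        by move=> u0 z0; field; rewrite ?u0 ?z0.
      by rewrite /e aux.
    by rewrite -powRM ?divr_ge0 ?(ltW C0) ?(ltW q0) ?N0// mulrA mulrAC.
  by apply: ler_prod => i _; rewrite powR_ge0 NB.
have dE : (n - s = d)%N by rewrite -[X in (X - _)%N]ds addnK.
have CnE : 'C(n, d) = 'C(d + s, s).
  by rewrite -[X in 'C(X, _)]ds -(bin_sub (leq_addl d s)) addnK.
have CkE i : 'C(n - #|sigmas i|, d) = 'C(d + k i, k i).
  rewrite -(bin_sub (leq_addl d (k i))) addnK -[X in (X - _)%N]ds.
  by rewrite -[s](size_filter_setC (sub i)) addnA addnK.
rewrite -/s dE CnE -/C; under eq_bigr do rewrite CkE.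
have mE : (p + lambda = m)%N by rewrite subnK// ltnW.
rewrite -(ler_pM2l (exprn_gt0 p (divr_gt0 C0 q0))) mulrA -exprMn.
have qm : 0 < q ^+ lambda by exact: exprn_gt0.
apply: (le_trans (ler_wpM2r (ltW qm) main)).
rewrite le_eqVlt; apply/orP; left; apply/eqP.
rewrite !big_split/= prodr_const card_ord.
(* One part of [q^-m] cancels the [q ^+ lambda] of the left side, the other the [q ^+ p] of the
   multiplier [(C / q) ^+ p]. *)
rewrite (_ : q^-1 ^+ m = (q ^+ p)^-1 * (q ^+ lambda)^-1); last first.
  by rewrite exprVn -[in LHS]mE exprD invfM.
rewrite expr_div_n.
have aux (P W a l c : R) : a != 0 -> l != 0 -> c != 0 ->
    P * (W * (a^-1 * l^-1)) * l = c / a * (P / c * W).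
  by move=> a0 l0 c0; field; rewrite ?a0 ?l0 ?c0.
by apply: aux; rewrite expf_neq0// gt_eqF.
Qed.

End uniform_cover_inequality.

(** * Degenerate covers and conclusion *)

Theorem theorem4 (R : realType) (n m lambda : nat) (sigma : {set 'I_n})
    (sigmas : 'I_m -> {set 'I_n}) (K : set 'rV[R]_n) :
  (1 <= lambda)%N -> (lambda <= m)%N ->
  uniform_cover lambda sigma sigmas ->
  convex_body K ->
  (volume K ^+ (m - lambda)%N *
     coord_volume sigma (orthoproj (coord_subspace sigma) @` K) ^+ lambda <=
   ((\prod_(i < m) ('C(n - #|sigmas i|, n - #|sigma|)%:R : R)) /
      'C(n, n - #|sigma|)%:R ^+ (m - lambda))%R%:E *
   \prod_(i < m)
     coord_volume (sigmas i) (orthoproj (coord_subspace (sigmas i)) @` K))%E.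
Proof.
move=> lam0 lamm cov [K0 cK convK].
have [b b0 Kb] := compact_box cK.
pose x : n.-tuple (measurableTypeR R) := [tuple 0 | i < n].
have mcyl tau : measurable (cyl tau K) by exact: compact_cyl_measurable.
have bcyl tau : bmf (\1_(cyl tau K) : n.-tuple (measurableTypeR R) -> R).
  exact: bmf_indic.
rewrite (volume_margs x (mcyl _) Kb) (coord_volume_margs x (mcyl sigma) Kb).
rewrite [X in (_ <= _ * X)%E](eq_bigr _
  (fun i _ => coord_volume_margs x (mcyl (sigmas i)) Kb)).
rewrite prodEFin -!EFin_expe -!EFinM lee_fin.
have ge0 s tau : 0 <= margs b s \1_(cyl tau K) x.
  by apply: margs_ge0 => y; case: (bcyl tau).
have [sub cov_card] := cov.
(* When all members of the cover equal [sigma], the binomials in the numerator are 1. This happens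
   for [lambda = m], where each [j] in [sigma] lies in every member, and for empty [sigma]. *)
have trivial_cover : (forall i, sigmas i = sigma) ->
    margs b (enum 'I_n) \1_(cyl finset.set0 K) x ^+ (m - lambda) *
      margs b (enum (~: sigma)) \1_(cyl sigma K) x ^+ lambda <=
    margs b (enum (~: sigma)) \1_(cyl sigma K) x ^+ m /
      'C(n, n - #|sigma|)%:R ^+ (m - lambda) ->
    margs b (enum 'I_n) \1_(cyl finset.set0 K) x ^+ (m - lambda) *
      margs b (enum (~: sigma)) \1_(cyl sigma K) x ^+ lambda <=
    (\prod_(i < m) 'C(n - #|sigmas i|, n - #|sigma|)%:R) /
      'C(n, n - #|sigma|)%:R ^+ (m - lambda) *
    \prod_(i < m) margs b (enum (~: sigmas i)) \1_(cyl (sigmas i) K) x.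
  move=> sE; rewrite big1 => [|i _]; last by rewrite sE binn.
  rewrite [X in _ -> _ <= _ * X](eq_bigr
    (fun=> margs b (enum (~: sigma)) \1_(cyl sigma K) x)) => [|i _]; last by rewrite sE.
  by rewrite prodr_const card_ord mul1r [X in _ -> _ <= X]mulrC.
have [lam_m|] := eqVneq lambda m.
  apply: trivial_cover => [i|]; last by rewrite lam_m subnn !expr0 mul1r divr1.
  apply/eqP; rewrite finset.eqEsubset sub; apply/fintype.subsetP => j js.
  have full : #|[set i | j \in sigmas i]| = #|'I_m| by rewrite cov_card// card_ord.
  have /(subset_cardP full)/(_ i) := subset_predT (mem [set i | j \in sigmas i]).
  by rewrite [RHS]inE => /set_mem.
rewrite eqn_leq lamm/= -ltnNge => lam_m.
have [sig0|sig0] := posnP #|sigma|.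
  have sE : sigma = finset.set0 by exact: cards0_eq.
  apply: trivial_cover => [i|].
    by apply/eqP; rewrite sE -finset.subset0 -sE.
  rewrite sig0 subn0 binn expr1n divr1 sE.
  rewrite (@eq_enum _ (~: finset.set0) 'I_n) => [|j]; last by rewrite !inE.
  by rewrite -exprD subnK.
have := ge0 (enum (~: sigma)) sigma.
(* If the projection has volume 0, the left side vanishes because [lambda > 0]. *)
rewrite le_eqVlt => /predU1P[<-|q0]; last exact: volume_cyl_le.
rewrite expr0n gtn_eqF// mulr0 mulr_ge0//.
  by rewrite divr_ge0 ?exprn_ge0 ?ler0n// prodr_ge0// => i _; rewrite ler0n.
by apply: prodr_ge0 => i _.
Qed.
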